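(* Let $K$ be any one of the following classes of functions $f:[0,1]\to\mathbb{R}$: - normalised $BV$-functions; - quasi-continuous $BV$-functions; - $BV$-functions satisfying $\min(f(x-),f(x+))\le f(x)\le\max(f(x-),f(x+))$ for $x\in(0,1)$; - $BV$-functions satisfying $f(x)=\frac{f(x+)+f(x-)}2$ for $x\in(0,1)$. Then there are functionals computable by $\exists^2$ which perform each of the following tasks on input any $f\in K$: (a) return $\sup_{x\in[p,q]}f(x)$ on further input $p,q\in[0,1]$; (b) return $(g,h)$ with $f=g-h$ on $[0,1]$ and $g,h:[0,1]\to\mathbb{R}$ non-decreasing; (c) return a point of $[0,1]$ at which $f$ is continuous; (d) return a point $x\in[0,1]$ at which the Fourier series of $f$ converges to $f(x)$; (e) in case $f$ takes values in $[0,1]$ and $\int_0^1f(x)\,dx=0$, return $x\in[0,1]$ with $f(x)=0$; (f) return a point $x_0\in[0,1]$ at which $F(x):=\int_0^xf(t)\,dt$ is differentiable with $F'(x_0)=f(x_0)$; (g) return a modulus of continuity for $f$; (h) return a modulus of regulation for $f$.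
   Context: Computability is Kleene's S1-S9 computability for total objects of finite type over $\mathbb{N}$ (metatheory ZFC). The partial relation $\{e\}(\vec\Phi)\simeq y$ ($y\in\mathbb{N}$, $\vec\Phi$ a list of finite-type objects) is inductively generated by: S1 successor $x+1$; S2 constants; S3 projection to a number argument; S4 composition $\{e_1\}(\{e_2\}(\vec\Phi),\vec\Phi)$; S5 primitive recursion; S6 permutation of arguments; S7 $\{e\}(f,x,\vec\Phi)=f(x)$ for $f\in\mathbb{N}^{\mathbb{N}}$; S8 $\{e\}(\Psi^{n+2},\vec\Phi)=\Psi(\lambda\xi^{n}.\{e_1\}(\xi,\Psi,\vec\Phi))$ when the inner function is total; S9 $\{e\}(d,\vec\Phi,\vec\Phi')=\{d\}(\vec\Phi)$. A functional is computable in $G$ if, after currying so that values are natural numbers, it equals $\lambda\vec\Phi.\{e\}(G,\vec\Phi)$ for some index $e$. Real numbers are represented by fast-converging Cauchy sequences of rationals (elements of $\mathbb{N}^{\mathbb{N}}$); functions $\mathbb{R}\to\mathbb{R}$ are maps on representations respecting equality of reals, and functions on $[0,1]$ are treated likewise (as inputs of type $\mathbb{R}\to\mathbb{R}$). $[p,q]$ presupposes $p\le q$. $\exists^2:\mathbb{N}^{\mathbb{N}}\to\{0,1\}$ satisfies $\exists^2(f)=0\leftrightarrow(\exists n)(f(n)=0)$. $f:[a,b]\to\mathbb{R}$ is in $BV$ (has bounded variation) if there is $k_0\in\mathbb{N}$ with $k_0\ge\sum_{i=0}^{n-1}|f(x_i)-f(x_{i+1})|$ for every partition $x_0=a<x_1<\dots<x_n=b$.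 $BV$-functions are regulated, i.e. the one-sided limits $f(x-)$ and $f(x+)$ exist (where they make sense). $f:[a,b]\to\mathbb{R}$ has normalised bounded variation if it is in $BV$, $f(a)=0$, and $f(x+)=f(x)$ for all $x\in[a,b)$. $f:[0,1]\to\mathbb{R}$ is quasi-continuous if for every $x_0\in[0,1]$, $\epsilon>0$ and (relatively) open neighbourhood $U$ of $x_0$ there is a non-empty open $G\subset U$ with $(\forall x\in G)(|f(x_0)-f(x)|<\epsilon)$. A modulus of continuity for $f$ (with $C_f\neq\emptyset$, $C_f$ the set of continuity points of $f$) is $F:(\mathbb{R}\times\mathbb{N})\to\mathbb{N}$ such that for all $k\in\mathbb{N}$, $x\in C_f$, $y\in[0,1]$: $|x-y|<\frac1{2^{F(x,k)}}\to|f(x)-f(y)|<\frac1{2^k}$. A modulus of regulation for regulated $f$ is $M:(\mathbb{R}\times\mathbb{N})\to\mathbb{N}$ such that for all $k\in\mathbb{N}$ and $x$ in the domain: $(\forall y\in(x,x+\frac1{2^{M(x,k)+1}}))(|f(x+)-f(y)|<\frac1{2^k})$ and $(\forall z\in(x-\frac1{2^{M(x,k)+1}},x))(|f(x-)-f(z)|<\frac1{2^k})$, with $y,z$ restricted to the domain of $f$ (only the one-sided condition that makes sense is imposed at endpoints). *)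

(* Defs.v *)
From mathcomp Require Import all_boot all_order all_algebra.
From mathcomp Require Import all_classical all_reals all_analysis.

Set Implicit Arguments.
Unset Strict Implicit.
Unset Printing Implicit Defensive.

Import Order.TTheory GRing.Theory Num.Theory numFieldNormedType.Exports.
Local Open Scope classical_set_scope.
Local Open Scope ring_scope.

Fixpoint pure (n : nat) : Set :=
  if n is m.+1 then pure m -> nat else nat.

Definition obj : Set := {n : nat & pure n}.

Definition Obj (n : nat) (x : pure n) : obj := existT pure n x.

Notation num x := (@Obj 0 x).
Notation code := CodeSeq.code.

(* [kleene e Phi y] is {e}(Phi) = y.  Indices are numbers, namely codes
   <i, ...> of finite sequences headed by the number i of the scheme.
   S6 carries the permutation tau, S9 the number of arguments kept. *)
Inductive kleene : nat -> seq obj -> nat -> Prop :=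
| kleene_S1 (x : nat) (Phi : seq obj) :
    kleene (code [:: 1%N]) (num x :: Phi) x.+1
| kleene_S2 (q : nat) (Phi : seq obj) :
    kleene (code [:: 2%N; q]) Phi q
| kleene_S3 (x : nat) (Phi : seq obj) :
    kleene (code [:: 3%N]) (num x :: Phi) x
| kleene_S4 (e1 e2 : nat) (Phi : seq obj) (y z : nat) :
    kleene e2 Phi y -> kleene e1 (num y :: Phi) z ->
    kleene (code [:: 4%N; e1; e2]) Phi z
| kleene_S5_zero (e1 e2 : nat) (Phi : seq obj) (y : nat) :
    kleene e1 Phi y ->
    kleene (code [:: 5%N; e1; e2]) (num 0%N :: Phi) y
| kleene_S5_succ (e1 e2 : nat) (x : nat) (Phi : seq obj) (y z : nat) :
    kleene (code [:: 5%N; e1; e2]) (num x :: Phi) y ->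
    kleene e2 [:: num x, num y & Phi] z ->
    kleene (code [:: 5%N; e1; e2]) (num x.+1 :: Phi) z
| kleene_S6 (e1 : nat) (tau : seq nat) (Phi : seq obj) (y : nat) :
    perm_eq tau (iota 0%N (size Phi)) ->
    kleene e1 [seq nth (num 0%N) Phi i | i <- tau] y ->
    kleene (code [:: 6%N; code tau; e1]) Phi y
| kleene_S7 (f : pure 1) (x : nat) (Phi : seq obj) :
    kleene (code [:: 7%N]) [:: Obj f, num x & Phi] (f x)
| kleene_S8 (e1 n : nat) (Psi : pure n.+2) (Phi : seq obj) (g : pure n.+1) :
    (forall xi : pure n, kleene e1 [:: Obj xi, Obj Psi & Phi] (g xi)) ->
    kleene (code [:: 8%N; e1]) (Obj Psi :: Phi) (Psi g)
| kleene_S9 (d : nat) (Phi Phi' : seq obj) (y : nat) :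
    kleene d Phi y ->
    kleene (code [:: 9%N; size Phi]) (num d :: Phi ++ Phi') y.

(* Outputs of type 1 and of types 1 -> 1 and 1 -> 0 -> 0 are curried until the
   value is a number. *)
Definition computes1 (G : obj) (e : nat) (Phi : seq obj) (y : nat -> nat) :=
  forall n : nat, kleene e (G :: Phi ++ [:: num n]) (y n).

Definition computes2 (G : obj) (e : nat) (Phi : seq obj)
    (F : (nat -> nat) -> nat -> nat) :=
  forall (x : nat -> nat) (n : nat),
    kleene e (G :: Phi ++ [:: @Obj 1 x; num n]) (F x n).

Definition seq_obj (x : nat -> nat) : obj := @Obj 1 x.

(* A type 1 -> 1 object as a pure object of type 2: phi x n is the value at the
   sequence n, x 0, x 1, ... *)
Definition op_obj (phi : (nat -> nat) -> nat -> nat) : obj :=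
  @Obj 2 (fun g : nat -> nat => phi (fun k => g k.+1) (g 0%N)).

Definition exists2_obj : obj :=
  @Obj 2 (fun f : nat -> nat =>
    if `[< exists n, f n = 0%N >] then 0%N else 1%N).

(* The number coding <a, b, c> denotes (a - b) / (c + 1); missing entries count
   as 0, so every number denotes a rational. *)
Definition rat_of_nat (n : nat) : rat :=
  let s := CodeSeq.decode n in
  ((nth 0%N s 0%N)%:R - (nth 0%N s 1%N)%:R) / (nth 0%N s 2%N).+1%:R.

Definition fast_cauchy (x : nat -> nat) : Prop :=
  forall n i : nat,
    `|rat_of_nat (x n) - rat_of_nat (x (n + i)%N)| < 2 ^- n.

Section Representations.
Variable R : realType.
Implicit Types (f : R -> R) (phi M : (nat -> nat) -> nat -> nat).

Definition represents (x : nat -> nat) (r : R) : Prop :=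
  fast_cauchy x /\ ratr (rat_of_nat (x n)) @[n --> \oo] --> r.

(* phi represents the restriction of f to [0, 1]; since [represents] is
   functional in r, such a phi respects equality of reals. *)
Definition realizes phi f : Prop :=
  forall x r, 0 <= r <= 1 -> represents x r -> represents (phi x) (f r).

Definition realizes_nat M (m : R -> nat -> nat) : Prop :=
  forall x r, represents x r -> forall k, M x k = m r k.

End Representations.

(* A function [0, 1] -> R is given by some f : R -> R whose values outside
   [0, 1] are irrelevant to all the notions below. *)
Section Classes.
Variable R : realType.
Implicit Types (f g h : R -> R) (x : R).

Local Notation I01 := (`[0, 1]%classic : set R).

Definition rlim f x : R := lim (f y @[y --> x^'+]).
Definition llim f x : R := lim (f y @[y --> x^'-]).

Definition normalised_BV : set (R -> R) :=
  [set f | [/\ bounded_variation 0 1 f, f 0 = 0 &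
    forall x, 0 <= x < 1 -> rlim f x = f x]].

Definition rel_open (U : set R) : Prop :=
  exists2 V : set R, open V & U = V `&` I01.

Definition quasi_continuous f : Prop :=
  forall x0 (eps : R) (U : set R),
    0 <= x0 <= 1 -> 0 < eps -> rel_open U -> U x0 ->
    exists G : set R, [/\ rel_open G, G !=set0, G `<=` U &
      forall x, G x -> `|f x0 - f x| < eps].

Definition quasi_continuous_BV : set (R -> R) :=
  [set f | bounded_variation 0 1 f /\ quasi_continuous f].

Definition intermediate_BV : set (R -> R) :=
  [set f | bounded_variation 0 1 f /\
    forall x, 0 < x < 1 ->
      Num.min (llim f x) (rlim f x) <= f x <= Num.max (llim f x) (rlim f x)].

Definition mean_BV : set (R -> R) :=
  [set f | bounded_variation 0 1 f /\
    forall x, 0 < x < 1 -> f x = (rlim f x + llim f x) / 2].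

Definition nondecreasing01 g : Prop :=
  forall x y, 0 <= x -> x <= y -> y <= 1 -> g x <= g y.

Definition continuous01_at f x : Prop :=
  f y @[y --> within I01 (nbhs x)] --> f x.

Definition fourier_cos f (k : nat) : R :=
  2 * \int[lebesgue_measure]_(t in I01) (f t * cos (2 * pi * k%:R * t)).

Definition fourier_sin f (k : nat) : R :=
  2 * \int[lebesgue_measure]_(t in I01) (f t * sin (2 * pi * k%:R * t)).

Definition fourier_sum f (N : nat) x : R :=
  fourier_cos f 0%N / 2 +
  \sum_(1 <= k < N.+1) (fourier_cos f k * cos (2 * pi * k%:R * x) +
                        fourier_sin f k * sin (2 * pi * k%:R * x)).

Definition primitive01 f x : R := \int[lebesgue_measure]_(t in `[0, x]) f t.

(* Derivative relative to [0, 1], hence one-sided at the end points. *)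
Definition has_derivative01_at (F : R -> R) x (d : R) : Prop :=
  (F y - F x) / (y - x) @[y --> within I01 x^'] --> d.

Definition modulus_of_continuity f (m : R -> nat -> nat) : Prop :=
  forall k x y, 0 <= x <= 1 -> continuous01_at f x -> 0 <= y <= 1 ->
    `|x - y| < 2 ^- m x k -> `|f x - f y| < 2 ^- k.

(* At x = 1 (resp. x = 0) no y (resp. z) satisfies the constraints. *)
Definition modulus_of_regulation f (m : R -> nat -> nat) : Prop :=
  forall k x, 0 <= x <= 1 ->
    (forall y, 0 <= y <= 1 -> x < y < x + 2 ^- (m x k).+1 ->
       `|rlim f x - f y| < 2 ^- k) /\
    (forall z, 0 <= z <= 1 -> x - 2 ^- (m x k).+1 < z < x ->
       `|llim f x - f z| < 2 ^- k).

(* The functional may be partial: it must be defined on every representation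
   phi of every f in K, and its value may depend on phi. *)
Definition returns_point (K : set (R -> R)) (P : (R -> R) -> R -> Prop) : Prop :=
  exists e : nat, forall f phi, K f -> realizes phi f ->
    exists x y, [/\ 0 <= x <= 1, P f x, represents y x &
      computes1 exists2_obj e [:: op_obj phi] y].

Definition returns_modulus (K : set (R -> R))
    (P : (R -> R) -> (R -> nat -> nat) -> Prop) : Prop :=
  exists e : nat, forall f phi, K f -> realizes phi f ->
    exists m M, [/\ P f m, realizes_nat M m &
      computes2 exists2_obj e [:: op_obj phi] M].

End Classes.

(* Main.v *)
Require Import Defs.
From mathcomp Require Import all_boot all_order all_algebra.
From mathcomp Require Import all_classical all_reals all_analysis.
From mathcomp Require Import measurable_realfun ring lra.
Import Order.TTheory GRing.Theory Num.Theory numFieldNormedType.Exports.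
Set Implicit Arguments.
Unset Strict Implicit.
Unset Printing Implicit Defensive.
Local Open Scope classical_set_scope.
Local Open Scope ring_scope.

(** Why the theorem holds.  Each of the four classes consists of functions of bounded
    variation on [0, 1] whose value at an interior point lies between the two one-sided
    limits there ([normalised_intermediate], [quasi_continuous_intermediate],
    [mean_intermediate]), so it suffices to treat the class of all such f.  For them, a
    bound satisfied at the rational points of an open interval is satisfied at all its
    points ([rational_bounds]).  Hence suprema, variations and moduli of f can be computed
    from its values at rationals, that is, by quantification over numbers, and exists2
    decides such quantifiers.

    Computability.  [computable C F] says that one index computes F i from the argument list
    attached to i, uniformly in i.  This class is closed under the application of type-2
    arguments (S8) and under primitive recursion, and self-application through S9 gives
    unbounded search ([comp_least]).  So the relations with a computable characteristic
    function ([dec]) are closed under first-order definitions over the numbers.  A real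
    depending on i is treated through its lower cut among the rationals ([computableR]):
    suprema, finite sums and arithmetic act on cuts by first-order formulas, a name is found
    by search ([comp_name]), and conversely a realizer applied to a name gives the cut of
    the value ([Rcomp_oracle]).

    Jordan decomposition.  Let W x be the supremum of the variation sums of f over finite
    chains of rationals in [0, x] followed by x itself ([rat_variation]).  A point x that is
    not rational can be replaced in a partition by two rationals on its sides at an
    arbitrarily small loss ([rational_insert]), whence W x + |f y - f x| <= W y for x <= y.
    So W and W - f are non-decreasing.

    One point serves for (c), (d), (e) and (f).  Inside an interval of length 4^-n take the
    two quarters next to its midpoint, and pass to the one on which W grows less.  The
    growth of W is at least halved, and the limit x stays at distance at least 4^-n/4 from
    the ends of the n-th interval, so |f t - f x| <= K 2^-n as soon as |t - x| <= 4^-n/4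
    ([var_point_slow]).  In particular f is continuous at x, which gives (c), (e) and (f).
    For (d), the n-th partial Fourier sum minus f x is the integral of (f t - f x) times the
    Dirichlet kernel at t - x.  On the ring |t - x| ~ 4^-m the kernel is O(4^m), the
    oscillation O(2^-m) and the length O(4^-m), so the rings near x contribute little,
    uniformly in the order of the kernel ([ring_bound]).  Away from x the integrand is a
    bounded function times sin((2N+1) pi (t - x)), and its integral tends to 0 by Bessel's
    inequality ([bessel_cvg]). *)

Local Notation code := CodeSeq.code.
Local Notation num n := (@Obj 0%N n).
Local Notation num0 := (@Obj 0%N 0%N).

(** * Kleene computability, uniformly over contexts *)

Lemma map_nth_drop (Phi : seq obj) (k m : nat) : (size Phi - k)%N = m ->
  [seq nth num0 Phi j | j <- iota k m] = drop k Phi.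
Proof. by move=> <-; rewrite map_nth_iota // take_oversize // size_drop. Qed.

(** Arguments may be reordered and dropped: S6 permutes the selected ones to the front, and
    S9 discards the others. *)
Lemma kleene_select (e m : nat) (tau : seq nat) :
  uniq tau -> all (fun j => j < m)%N tau ->
  exists e', forall (Phi : seq obj) y, size Phi = m ->
    kleene e [seq nth num0 Phi j | j <- tau] y -> kleene e' Phi y.
Proof.
move=> utau ltau.
pose rest := [seq j <- iota 0 m | j \notin tau].
exists (code [:: 6%N; code (cat tau rest);
              code [:: 4%N; code [:: 9%N; size tau]; code [:: 2%N; e]]]).
move=> Phi y sPhi ke; apply: kleene_S6.
  rewrite sPhi; apply: uniq_perm; rewrite ?iota_uniq //.
    rewrite cat_uniq utau filter_uniq ?iota_uniq // andbT.
    by apply/hasPn => j; rewrite mem_filter => /andP[].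
  move=> j; rewrite mem_cat mem_filter mem_iota /= add0n.
  case: (boolP (j \in tau)) => //= jtau.
  by rewrite (allP ltau).
apply: kleene_S4; first exact: kleene_S2.
rewrite map_cat -[X in code [:: 9%N; X]](size_map (nth num0 Phi)).
exact: kleene_S9.
Qed.

(** A family of argument lists of constant length, each with exists2 at one fixed place and a
    type-2 object, the realizer of the input function, at another.  Indexing by an arbitrary
    type expresses uniformity without a syntax of terms. *)
Record ctx := Ctx {
  idx : Type;
  args : idx -> seq obj;
  width : nat;
  fn : idx -> pure 2;
  expos : nat;
  fnpos : nat;
  size_args : forall i, size (args i) = width;
  expos_lt : (expos < width)%N;
  fnpos_lt : (fnpos < width)%N;
  nth_expos : forall i, nth num0 (args i) expos = exists2_obj;
  nth_fnpos : forall i, nth num0 (args i) fnpos = @Obj 2 (fn i) }.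

Arguments args {c} _.

(** A number variable is bound by putting it in front, as the schemes do. *)
Definition ext (C : ctx) : ctx.
Proof.
refine (@Ctx (idx C * nat) (fun p => num p.2 :: args p.1) (width C).+1
  (fun p => fn p.1) (expos C).+1 (fnpos C).+1 _ _ _ _ _).
- by move=> i /=; rewrite size_args.
- exact: expos_lt.
- exact: fnpos_lt.
- by move=> i; exact: nth_expos.
- by move=> i; exact: nth_fnpos.
Defined.

Definition computable (C : ctx) (F : idx C -> nat) : Prop :=
  exists e, forall i, kleene e (args i) (F i).
Arguments computable : clear implicits.

(** The argument lists of [D] contain those of [C], up to order, at places that do not
    depend on the index.  This is how a computation is moved under further binders. *)
Definition reindex (C D : ctx) (pi : idx D -> idx C) : Prop :=
  exists tau, [/\ uniq tau, all (fun j => j < width D)%N tau &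
    forall i, args (pi i) = [seq nth num0 (args i) j | j <- tau]].
Arguments reindex : clear implicits.

Lemma reindex_refl C : reindex C C id.
Proof.
exists (iota 0 (width C)); split; first exact: iota_uniq.
  by apply/allP => j; rewrite mem_iota.
by move=> i; rewrite map_nth_drop ?drop0 ?size_args ?subn0.
Qed.

Lemma reindex_skip C D (pi : idx D -> idx C) :
  reindex C D pi -> reindex C (ext D) (fun p => pi p.1).
Proof.
move=> [tau [utau ltau hpi]]; exists (map S tau); split.
- by rewrite (map_inj_uniq succn_inj).
- by rewrite all_map.
- by move=> [i n] /=; rewrite hpi -map_comp.
Qed.

Lemma reindex_lift C D (pi : idx D -> idx C) :
  reindex C D pi -> reindex (ext C) (ext D) (fun p => (pi p.1, p.2)).
Proof.
move=> [tau [utau ltau hpi]]; exists (0%N :: map S tau); split.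
- rewrite cons_uniq (map_inj_uniq succn_inj) utau andbT.
  by apply/negP => /mapP[].
- by rewrite /= all_map.
- by move=> [i n] /=; rewrite hpi -map_comp.
Qed.

Lemma comp_reindex C D (pi : idx D -> idx C) (F : idx C -> nat) :
  reindex C D pi -> computable C F -> computable D (fun i => F (pi i)).
Proof.
move=> [tau [utau ltau hpi]] [e he].
have [e' he'] := @kleene_select e (width D) tau utau ltau.
by exists e' => i; apply: he'; rewrite ?size_args // -hpi.
Qed.

Section Closure.
Variable C : ctx.
Local Notation I := (idx C).

Lemma eq_comp (F G : I -> nat) : F =1 G -> computable C F -> computable C G.
Proof. by move=> FG [e he]; exists e => i; rewrite -FG. Qed.

Lemma comp_cst (q : nat) : computable C (fun=> q).
Proof. by exists (code [:: 2%N; q]) => i; exact: kleene_S2. Qed.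

Lemma comp_subst (G : I -> nat -> nat) (a : I -> nat) :
  computable (ext C) (fun p => G p.1 p.2) -> computable C a ->
    computable C (fun i => G i (a i)).
Proof.
move=> [e he] [d hd]; exists (code [:: 4%N; e; d]) => i.
by apply: kleene_S4 (hd i) _; exact: (he (i, a i)).
Qed.

Lemma comp_weak (F : I -> nat) :
  computable C F -> computable (ext C) (fun p => F p.1).
Proof. exact: comp_reindex (reindex_skip (reindex_refl C)). Qed.

Lemma comp_var : computable (ext C) (fun p => p.2).
Proof. by exists (code [:: 3%N]) => -[i n]; exact: kleene_S3. Qed.

Lemma comp_succ (a : I -> nat) : computable C a -> computable C (fun i => (a i).+1).
Proof.
move=> ca; apply: (@comp_subst (fun=> succn)) => //.
by exists (code [:: 1%N]) => -[i n]; exact: kleene_S1.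
Qed.

Lemma comp_type1 (u : I -> nat -> nat) (j : nat) :
  (forall i : I, (j < size (args i))%N) ->
  (forall i : I, nth num0 (args i) j = @Obj 1 (u i)) ->
  computable (ext C) (fun p => u p.1 p.2).
Proof.
move=> lj hj.
have [ltj|gej] := ltnP j (width C); last first.
  exists 0%N => -[i n]; move: (lj i); rewrite size_args ltnNge gej //.
have [||e' he'] := @kleene_select (code [:: 7%N]) (width C).+1 [:: j.+1; 0%N].
- by [].
- by rewrite /= ltnS ltj.
exists e' => -[i n] /=; apply: he' => /=; first by rewrite size_args.
by rewrite hj; exact: kleene_S7.
Qed.

(** S8 needs the type-2 argument in front, and leaves it behind the new variable; the inverse
    permutation restores the order expected by the index of g. *)
Lemma comp_type2 (Psi : I -> pure 2) (g : I -> nat -> nat) (j : nat) :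
  (j < width C)%N -> (forall i : I, nth num0 (args i) j = @Obj 2 (Psi i)) ->
  computable (ext C) (fun p => g p.1 p.2) -> computable C (fun i => Psi i (g i)).
Proof.
move=> lj hj [e he]; set m := width C.
pose tau := j :: rem j (iota 0 m).
have jm : j \in iota 0 m by rewrite mem_iota.
have ptau : perm_eq tau (iota 0 m) by rewrite perm_sym perm_to_rem.
have utau : uniq tau by rewrite (perm_uniq ptau) iota_uniq.
have stau : size tau = m by rewrite (perm_size ptau) size_iota.
pose sigma := 0%N :: [seq (index i tau).+1 | i <- iota 0 m].
have [||e1 he1] := @kleene_select e m.+1 sigma.
- rewrite cons_uniq map_inj_in_uniq ?iota_uniq ?andbT.
    by apply/negP => /mapP[].
  move=> x y; rewrite -!(perm_mem ptau) => xt yt /succn_inj xy.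
  by rewrite -(nth_index 0%N xt) xy nth_index.
- apply/allP => x; rewrite inE => /orP[/eqP->//|/mapP[k km ->]].
  by rewrite ltnS -[X in (_ < X)%N]stau index_mem (perm_mem ptau).
exists (code [:: 6%N; code tau; code [:: 8%N; e1]]) => i.
apply: kleene_S6; first by rewrite size_args.
rewrite /tau /= hj; apply: kleene_S8 => n.
apply: he1; first by rewrite /= size_map size_rem // size_iota prednK // (leq_ltn_trans
  _ lj).
rewrite /sigma /= -map_comp.
suff -> : [seq ([eta nth num0 [:: @Obj 0 n, @Obj 2 (Psi i)
    & [seq nth num0 (args i) k | k <- rem j (iota 0 m)]]]
    \o (fun i0 => (index i0 tau).+1)) k | k <- iota 0 m] = args i.
  exact: (he (i, n)).
apply: (@eq_from_nth _ num0) => [|k]; rewrite size_map size_iota ?size_args // => km.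
rewrite (nth_map 0%N) ?size_iota // nth_iota // add0n.
have kt : k \in tau by rewrite (perm_mem ptau) mem_iota.
transitivity (nth num0 [seq nth num0 (args i) k | k <- tau] (index k tau)).
  by rewrite /tau map_cons hj.
by rewrite (nth_map 0%N) ?index_mem // nth_index.
Qed.

Lemma comp_primrec (a : I -> nat) (h : I -> nat -> nat -> nat) :
  computable C a -> computable (ext (ext C)) (fun p => h p.1.1 p.2 p.1.2) ->
  computable (ext C) (fun p => nat_rect (fun=> nat) (a p.1) (h p.1) p.2).
Proof.
move=> [d hd] [e he]; exists (code [:: 5%N; d; e]) => -[i n] /=.
elim: n => [|n IHn]; first exact: kleene_S5_zero.
by apply: kleene_S5_succ IHn _; exact: (he (i, _, n)).
Qed.

End Closure.


(** S5 on a test with values 0 and 1 is a conditional that never evaluates e1 when the test is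
    0; this makes it safe to put a recursive call there. *)
Lemma kleene_if (et e0 e1 : nat) (Phi : seq obj) (y z : nat) (b : bool) :
  kleene et Phi (b : nat) -> kleene e0 Phi z ->
  (if b then kleene e1 [:: num0, num z & Phi] y else y = z) ->
  kleene (code [:: 4%N; code [:: 5%N; e0; e1]; et]) Phi y.
Proof.
case: b => kt k0 k1; apply: kleene_S4 kt _.
  by apply: kleene_S5_succ k1; exact: kleene_S5_zero k0.
by rewrite k1; exact: kleene_S5_zero.
Qed.

(** Truth is coded by 0, to agree with the equation f n = 0 that exists2 tests. *)
Definition dec (C : ctx) (P : idx C -> Prop) : Prop :=
  computable C (fun i => ~~ `[< P i >] : nat).
Arguments dec : clear implicits.

Definition least (P : nat -> Prop) : nat :=
  if pselect (exists n, `[< P n >]) is left h then ex_minn h else 0%N.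

Lemma leastP (P : nat -> Prop) : (exists n, P n) -> P (least P).
Proof.
move=> [n Pn]; rewrite /least; case: pselect => [h|[]]; last first.
  by exists n; apply/asboolP.
by case: ex_minnP => k /asboolP.
Qed.

Section Decidable.
Variable C : ctx.
Local Notation I := (idx C).
Implicit Types P Q : I -> Prop.

Lemma eq_dec P Q : (forall i, P i <-> Q i) -> dec C P -> dec C Q.
Proof.
move=> PQ; apply: eq_comp => i; congr (nat_of_bool (~~ _)).
by apply/asbool_equiv_eq.
Qed.

Lemma dec_weak P : dec C P -> dec (ext C) (fun p => P p.1).
Proof. by move=> dP; apply: (comp_weak dP). Qed.

Lemma dec_subst (P : I -> nat -> Prop) (a : I -> nat) :
  dec (ext C) (fun p => P p.1 p.2) -> computable C a -> dec C (fun i => P i (a i)).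
Proof.
by move=> dP ca; exact: (@comp_subst C (fun i n => ~~ `[< P i n >] : nat)).
Qed.

Lemma dec_ex (P : I -> nat -> Prop) :
  dec (ext C) (fun p => P p.1 p.2) -> dec C (fun i => exists n, P i n).
Proof.
move=> dP; have := comp_type2 (expos_lt C)
  (fun i => nth_expos i) (g := fun i n => ~~ `[< P i n >] : nat) dP.
apply: eq_comp => i; case: asboolP => [[n]|].
  move=> h; case: asboolP => // -[]; exists n.
  by move/eqP: h; rewrite eqb0 negbK => /asboolP.
move=> h; case: asboolP => // -[n Pn]; case: h; exists n.
by apply/eqP; rewrite eqb0 negbK; apply/asboolP.
Qed.

Lemma dec_eq0 (a : I -> nat) : computable C a -> dec C (fun i => a i = 0%N).
Proof.
move=> ca; have := comp_type2 (expos_lt C)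
  (fun i => nth_expos i) (g := fun i n => a i) (comp_weak ca).
apply: eq_comp => i; case: asboolP => [[n ->]|h]; first by rewrite asboolT.
by rewrite asboolF // => ai; apply: h; exists 0%N.
Qed.

End Decidable.

Section Search.
Variables (C : ctx) (P : idx C -> nat -> Prop).
Hypothesis dP : dec (ext C) (fun p => P p.1 p.2).

(** The index b receives itself as first argument and calls itself through S9; this replaces
    the recursion theorem. *)
Lemma kleene_search : exists b, forall (i : idx C) n N,
  (n <= N)%N -> P i N -> (forall k, (k < N)%N -> ~ P i k) ->
  kleene b [:: num b, num n & args i] N.
Proof.
have [e he] := dP; set w := width C.
(* The test reads the list d, n, Phi, where d is the index b itself. *)
have [||et het] := @kleene_select e w.+2 (iota 1 w.+1).
- exact: iota_uniq.
- by apply/allP => j; rewrite mem_iota add1n => /andP[].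
(* The answer n when the test succeeds. *)
have [||e0 he0] := @kleene_select (code [:: 3%N]) w.+2 [:: 1%N] => //.
(* The recursive call finds the list d, n+1, 0, n, d, n, Phi: the entries 0 and n come
   from S5, and the copies of d and n+1 from S4. *)
have [||er her] := @kleene_select (code [:: 9%N; w.+2]) (w.+4.+2)
  [:: 0, 4, 1 & iota 6 w]%N.
- by rewrite /= !inE !mem_iota /= iota_uniq.
- apply/allP => j; rewrite !inE mem_iota.
  case/or4P => [/eqP->//|/eqP->//|/eqP->//|/andP[_]].
  by rewrite addnC !addnS addn0.
have [||es hes] := @kleene_select (code [:: 1%N]) w.+4 [:: 3%N] => //.
have [||ed hed] := @kleene_select (code [:: 3%N]) w.+4.+1 [:: 3%N] => //.
exists (code [:: 4%N; code [:: 5%N; e0; code [:: 4%N; code [:: 4%N; er; ed]; es]]; et]).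
set b := code _; move=> i n N nN PN minN.
have szi : size (args i) = w by rewrite size_args.
have sel (d m : nat) : [seq nth num0 [:: num d, num m & args i] j | j <- iota 1 w.+1] =
    num m :: args i.
  by rewrite map_nth_drop //= szi subn1.
have [m Nnm] : exists m, (N - n)%N = m by exists (N - n)%N.
elim: m n Nnm nN => [|m IHm] n Nnm nN.
all: apply: (@kleene_if _ _ _ _ _ n (~~ `[< P i n >])).
all: try (apply: het; [by rewrite /= szi|rewrite sel; exact: (he (i, n))]).
all: try (apply: he0; [by rewrite /= szi|exact: kleene_S3]).
  have nE : n = N by apply/eqP; rewrite eqn_leq nN /= -subn_eq0 Nnm.
  by rewrite nE asboolT.
case: asboolP => [Pn|_] /=.
  have : ~ (n < N)%N by move=> /minN.
  by move=> /negP; rewrite -subn_gt0 Nnm.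
have ltnN : (n < N)%N by rewrite -subn_gt0 Nnm.
apply: (@kleene_S4 _ _ _ n.+1).
  by apply: hes; [rewrite /= szi|exact: kleene_S1].
apply: (@kleene_S4 _ _ _ b).
  by apply: hed; [rewrite /= szi|exact: kleene_S3].
apply: her; first by rewrite /= szi.
have -> : [seq nth num0 [:: num b, num n.+1, num0, num n, num b, num n & args i] j
   | j <- [:: 0, 4, 1 & iota 6 w]%N] = (num b :: [:: num b,
     num n.+1 & args i] ++ [::])%SEQ.
  by rewrite cats0 /= map_nth_drop /= ?drop0 // szi !subSS subn0.
have -> : w.+2 = size [:: num b, num n.+1 & args i] by rewrite /= szi.
apply: kleene_S9; apply: IHm => //.
by rewrite subnS Nnm.
Qed.

End Search.

(** The search is only started when exists2 guarantees that it ends, so the value is defined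
    everywhere. *)
Lemma comp_least (C : ctx) (P : idx C -> nat -> Prop) :
  dec (ext C) (fun p => P p.1 p.2) -> computable C (fun i => least (P i)).
Proof.
move=> dP; have [b hb] := kleene_search dP.
have [et het] := dec_ex (P := fun i n => P i n) dP.
set w := width C.
have [||er her] := @kleene_select (code [:: 4%N; code [:: 4%N; b; code [:: 2%N; b]];
  code [:: 2%N; 0%N]]) w.+2 (iota 2 w).
- exact: iota_uniq.
- by apply/allP => j; rewrite mem_iota => /andP[_]; rewrite addnC addn2.
have [en hen] : dec C (fun i => ~ exists n, P i n).
  have cr := @comp_primrec C (fun=> 1%N) (fun _ _ _ => 0%N)
    (comp_cst _ _) (comp_cst _ _).
  have cex : computable C (fun i => ~~ `[< exists n, P i n >] : nat) by exists et.
  have := @comp_subst C (fun i t => nat_rect (fun=> nat) 1%N (fun _ _ => 0%N) t)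
    _ cr cex.
  by apply: eq_comp => i; rewrite asbool_neg; case: asboolP.
exists (code [:: 4%N; code [:: 5%N; code [:: 2%N; 0%N]; er]; en]) => i.
apply: (@kleene_if _ _ _ _ _ 0%N _ (hen i)); first exact: kleene_S2.
case: asboolP => [nex|nnex] /=.
  by rewrite /least; case: pselect => // h; case: nex; case: h => n /asboolP; exists n.
have [n Pn] := contrapT nnex; rewrite /least; case: pselect => [h|[]]; last first.
  by exists n; apply/asboolP.
case: ex_minnP => N /asboolP PN minN.
apply: her; first by rewrite /= size_args.
have -> : [seq nth num0 [:: num0, num0 & args i] j | j <- iota 2 w] = args i.
  by rewrite map_nth_drop /= ?drop0 // size_args subn2.
apply: kleene_S4; first exact: kleene_S2.
apply: kleene_S4; first exact: kleene_S2.
apply: hb => // k kN Pk; move: kN; rewrite ltnNge minN //.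
by apply/asboolP.
Qed.

(** * Arithmetic and first-order definitions *)

Section Arithmetic.
Variable C : ctx.
Local Notation I := (idx C).
Implicit Types (P Q : I -> Prop) (a b : I -> nat).

Lemma comp_iter a b (h : I -> nat -> nat -> nat) :
  computable C a -> computable C b ->
    computable (ext (ext C)) (fun p => h p.1.1 p.2 p.1.2) ->
  computable C (fun i => nat_rect (fun=> nat) (a i) (h i) (b i)).
Proof.
move=> ca cb ch; exact: (@comp_subst C (fun i => nat_rect (fun=> nat) (a i) (h i)) b
  (comp_primrec ca ch) cb).
Qed.

Lemma comp_pred a : computable C a -> computable C (fun i => (a i).-1).
Proof.
move=> ca; have := comp_iter (h := fun _ x _ => x) (comp_cst C 0) ca (comp_var _).
by apply: eq_comp => i; case: (a i).
Qed.
End Arithmetic.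

Section Decisions.
Variable C : ctx.
Local Notation I := (idx C).
Implicit Types (P Q : I -> Prop) (a b : I -> nat).

Lemma comp_acc : computable (ext (ext C)) (fun p => p.1.2).
Proof. exact: (comp_weak (comp_var _)). Qed.

Lemma comp_add a b : computable C a -> computable C b ->
  computable C (fun i => a i + b i)%N.
Proof.
move=> ca cb; have := comp_iter (h := fun _ _ y => y.+1) ca cb (comp_succ comp_acc).
by apply: eq_comp => i; elim: (b i) => [|n /= ->]; rewrite ?addn0 ?addnS.
Qed.

Lemma comp_sub a b : computable C a -> computable C b ->
  computable C (fun i => a i - b i)%N.
Proof.
move=> ca cb; have := comp_iter (h := fun _ _ y => y.-1) ca cb (comp_pred comp_acc).
by apply: eq_comp => i; elim: (b i) => [|n /= ->]; rewrite ?subn0 ?subnS.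
Qed.

Lemma dec_not P : dec C P -> dec C (fun i => ~ P i).
Proof.
move=> dP; have := comp_sub (comp_cst C 1) dP.
by apply: eq_comp => i; rewrite asbool_neg; case: asboolP.
Qed.

Lemma dec_and P Q : dec C P -> dec C Q -> dec C (fun i => P i /\ Q i).
Proof.
move=> dP dQ; apply: eq_dec (dec_eq0 (comp_add dP dQ)) => i.
by case: asboolP => hP; case: asboolP => hQ; split => // -[].
Qed.

Lemma dec_andb (P Q : I -> bool) : dec C P -> dec C Q -> dec C (fun i => P i && Q i).
Proof.
by move=> dP dQ; apply: eq_dec (dec_and dP dQ) => i; split => /andP.
Qed.

Lemma dec_or P Q : dec C P -> dec C Q -> dec C (fun i => P i \/ Q i).
Proof.
move=> dP dQ; apply: eq_dec (dec_not (dec_and (dec_not dP) (dec_not dQ))) => i.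
by rewrite not_andP !notK.
Qed.

Lemma dec_imp P Q : dec C P -> dec C Q -> dec C (fun i => P i -> Q i).
Proof.
move=> dP dQ; apply: eq_dec (dec_or (dec_not dP) dQ) => i.
by rewrite implyE.
Qed.



Lemma dec_leq a b : computable C a -> computable C b -> dec C (fun i => a i <= b i)%N.
Proof.
move=> ca cb; apply: eq_dec (dec_eq0 (comp_sub ca cb)) => i.
by rewrite -subn_eq0; split => /eqP.
Qed.

Lemma dec_ltn a b : computable C a -> computable C b -> dec C (fun i => a i < b i)%N.
Proof. by move=> ca cb; exact: dec_leq (comp_succ ca) cb. Qed.

Lemma dec_eqn a b : computable C a -> computable C b -> dec C (fun i => a i = b i).
Proof.
move=> ca cb; apply: eq_dec (dec_and (dec_leq ca cb) (dec_leq cb ca)) => i.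
by split => [[h1 h2]|-> //]; apply/eqP; rewrite eqn_leq h1.
Qed.

End Decisions.

Lemma dec_all (C : ctx) (P : idx C -> nat -> Prop) :
  dec (ext C) (fun p => P p.1 p.2) -> dec C (fun i => forall n, P i n).
Proof.
move=> dP; apply: eq_dec (dec_not (dec_ex (P := fun i n => ~ P i n) (dec_not dP))) => i.
by split=> [h n|h [n]//]; apply: contrapT => nP; apply: h; exists n.
Qed.

Section Products.
Variable C : ctx.
Local Notation I := (idx C).
Implicit Types (P Q : I -> Prop) (a b : I -> nat).

Lemma comp_mul a b : computable C a -> computable C b ->
  computable C (fun i => a i * b i)%N.
Proof.
move=> ca cb; have := comp_iter (h := fun i _ y => (a i + y)%N) (comp_cst C 0) cb
  (comp_add (comp_weak (comp_weak ca)) (comp_acc C)).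
by apply: eq_comp => i; elim: (b i) => [|n /= ->]; rewrite ?muln0 ?mulnS.
Qed.

(** A function with a decided graph is found by search, so first-order definability is enough
    for computability. *)
Lemma comp_graph (F : I -> nat) : dec (ext C) (fun p => p.2 = F p.1) -> computable C F.
Proof.
move=> dF; apply: eq_comp (comp_least (P := fun i n => n = F i) dF) => i.
by apply: (leastP (P := fun n => n = F i)); exists (F i).
Qed.

Lemma comp_if P a b : dec C P -> computable C a -> computable C b ->
  computable C (fun i => if `[< P i >] then a i else b i).
Proof.
move=> dP ca cb; apply: comp_graph.
apply: (@eq_dec (ext C) (fun p => (P p.1 /\ p.2 = a p.1) \/ (~ P p.1 /\ p.2 = b p.1))).
  by case=> i n /=; case: asboolP => h; split => [[[]|[]]//|->]; [left|right].
by apply: dec_or; apply: dec_and; rewrite ?dec_eqn //;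
  do ?[apply: dec_not]; do ?[exact: dec_weak]; apply: dec_eqn (comp_var _) (comp_weak _).
Qed.

End Products.

Lemma comp_exp2 (C : ctx) (a : idx C -> nat) : computable C a ->
  computable C (fun i => 2 ^ a i)%N.
Proof.
move=> ca; have := comp_iter (h := fun i _ y => (2 * y)%N) (comp_cst C 1) ca
  (comp_mul (comp_cst _ 2) (comp_acc C)).
by apply: eq_comp => i; elim: (a i) => [|n /= ->]; rewrite ?expn0 ?expnS.
Qed.

Definition code_head (n : nat) : nat := head 0%N (CodeSeq.decode n).
Definition code_tail (n : nat) : nat := code (behead (CodeSeq.decode n)).
Definition entry (n k : nat) : nat := nth 0%N (CodeSeq.decode n) k.

Lemma decode_cons (n h t : nat) : n = (2 ^ h * (t.*2.+1))%N ->
  CodeSeq.decode n = h :: CodeSeq.decode t.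
Proof.
by move=> ->; rewrite -[RHS]CodeSeq.codeK /= CodeSeq.decodeK.
Qed.

Section Lists.
Variables (C : ctx) (a : idx C -> nat).
Hypothesis ca : computable C a.
Local Notation I := (idx C).

(** The defining property of the code of a sequence, from which its head and tail are
    recovered by arithmetic definitions. *)
Lemma decode_eq (n : nat) : n = 0%N \/ n = (2 ^ code_head n * (code_tail n).*2.+1)%N.
Proof.
case dE: (CodeSeq.decode n) (CodeSeq.decodeK n) => [|h t] nE; first by left.
by right; rewrite -{1}nE /code_head /code_tail dE.
Qed.

Lemma comp_code_head : computable C (fun i => code_head (a i)).
Proof.
apply: comp_graph; apply: (@eq_dec (ext C) (fun p => (a p.1 = 0%N /\ p.2 = 0%N) \/
  exists t, a p.1 = (2 ^ p.2 * (t + t).+1)%N)).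
  case=> i n /=; split => [[[-> ->]//|[t]]|->].
    by rewrite addnn => /decode_cons; rewrite /code_head => ->.
  case: (decode_eq (a i)) => [->|e]; [by left|right].
  by exists (code_tail (a i)); rewrite addnn.
apply: dec_or.
  apply: dec_and (dec_eqn (comp_weak ca) (comp_cst _ _)) (dec_eqn (comp_var _)
    (comp_cst _ _)).
apply: dec_ex (dec_eqn (comp_weak (comp_weak ca)) (comp_mul (comp_exp2 (comp_acc _))
  (comp_succ (comp_add (comp_var _) (comp_var _))))).
Qed.

Lemma comp_code_tail : computable C (fun i => code_tail (a i)).
Proof.
apply: comp_graph; apply: (@eq_dec (ext C) (fun p => (a p.1 = 0%N /\ p.2 = 0%N) \/
  exists h, a p.1 = (2 ^ h * (p.2 + p.2).+1)%N)).
  case=> i n /=; split => [[[-> ->]//|[t]]|->].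
    by rewrite addnn => /decode_cons; rewrite /code_tail => -> /=;
      rewrite CodeSeq.decodeK.
  case: (decode_eq (a i)) => [->|e]; [by left|right].
  by exists (code_head (a i)); rewrite addnn.
apply: dec_or.
  apply: dec_and (dec_eqn (comp_weak ca) (comp_cst _ _)) (dec_eqn (comp_var _)
    (comp_cst _ _)).
apply: dec_ex (dec_eqn (comp_weak (comp_weak ca)) (comp_mul (comp_exp2 (comp_var _))
  (comp_succ (comp_add (comp_acc _) (comp_acc _))))).
Qed.

End Lists.

Lemma comp_entry (C : ctx) (a b : idx C -> nat) : computable C a -> computable C b ->
  computable C (fun i => entry (a i) (b i)).
Proof.
move=> ca cb; have := comp_code_head (comp_iter (h := fun i _ y => code_tail y) ca cb
  (comp_code_tail (comp_acc C))).
apply: eq_comp => i; rewrite /code_head /entry -nth0.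
suff -> : CodeSeq.decode (nat_rect (fun=> nat) (a i) (fun _ y => code_tail y) (b i)) =
   drop (b i) (CodeSeq.decode (a i)) by rewrite nth_drop addn0.
elim: (b i) => [|n IHn] /=; first by rewrite drop0.
by rewrite /code_tail CodeSeq.codeK IHn -drop1 drop_drop add1n.
Qed.

(** * Reals given by their lower cuts *)

Section Rationals.
Variable R : realType.

Definition rat_real (c : nat) : R := ratr (rat_of_nat c).

Lemma rat_realE c : rat_real c = ((entry c 0)%:R - (entry c 1)%:R) / (entry c 2).+1%:R.
Proof. by rewrite /rat_real /rat_of_nat fmorph_div rmorphB /= !ratr_nat. Qed.

Lemma rat_real0 : rat_real 0 = 0.
Proof. by rewrite rat_realE /entry /= subrr mul0r. Qed.

Lemma rat_of_nat_surj (q : rat) : exists c, rat_of_nat c = q.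
Proof.
pose a := numq q; pose s := if 0 <= a then [:: `|a|; 0; `|denq q|.-1]%N else [:: 0;
  `|a|; `|denq q|.-1]%N.
exists (code s); rewrite /rat_of_nat CodeSeq.codeK.
have dE : (`|denq q|.-1.+1)%:R = (denq q)%:~R :> rat.
  rewrite prednK ?absz_gt0 ?denq_neq0 // natr_absz ger0_norm //; exact: denq_ge0.
rewrite -[RHS]divq_num_den /s; case: ifP => a0 /=; rewrite dE ?subr0 ?sub0r natr_absz.
  by rewrite ger0_norm.
by rewrite ltr0_norm ?ltNge ?a0 // mulrNz opprK.
Qed.

Lemma rat_real_dense (x y : R) : x < y -> exists c, x < rat_real c < y.
Proof.
move=> /rat_in_itvoo[q]; rewrite in_itv /= => xqy.
by have [c cq] := rat_of_nat_surj q; exists c; rewrite /rat_real cq.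
Qed.

Lemma lt_sum_fractions (a0 a1 b0 b1 c0 c1 d0 d1 A B C D : nat) :
  (a0%:R - a1%:R) / A.+1%:R + (b0%:R - b1%:R) / B.+1%:R <
  (c0%:R - c1%:R) / C.+1%:R + (d0%:R - d1%:R) / D.+1%:R :> R <->
  (a0 * B.+1 * C.+1 * D.+1 + b0 * A.+1 * C.+1 * D.+1 +
   c1 * A.+1 * B.+1 * D.+1 + d1 * A.+1 * B.+1 * C.+1 <
   a1 * B.+1 * C.+1 * D.+1 + b1 * A.+1 * C.+1 * D.+1 +
   c0 * A.+1 * B.+1 * D.+1 + d0 * A.+1 * B.+1 * C.+1)%N.
Proof.
rewrite -(ltr_nat R) !natrD !natrM.
have : 0 < A.+1%:R * B.+1%:R * C.+1%:R * D.+1%:R :> R by rewrite !mulr_gt0.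
have : [/\ A.+1%:R != 0 :> R, B.+1%:R != 0 :> R, C.+1%:R != 0 :> R & D.+1%:R != 0 :> R].
  by rewrite !pnatr_eq0.
move: (A.+1%:R : R) (B.+1%:R : R) (C.+1%:R : R) (D.+1%:R : R) => a b c d [a00 b00 c00
  d00] pos.
have scale (u v p q k : R) : 0 < k -> (v - u) * k = q - p -> u < v <-> p < q.
  by move=> k0 e; rewrite -subr_gt0 -(pmulr_lgt0 _ k0) e subr_gt0.
apply: (scale _ _ _ _ _ pos).
by field; rewrite a00 b00 c00 d00.
Qed.

Lemma dec_qsum (C : ctx) (a b c d : idx C -> nat) :
  computable C a -> computable C b -> computable C c -> computable C d ->
  dec C (fun i => rat_real (a i) + rat_real (b i) < rat_real (c i) + rat_real (d i)).
Proof.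
move=> ca cb cc cd.
apply: eq_dec; first by move=> i; rewrite !rat_realE; symmetry; exact: lt_sum_fractions.
apply: dec_ltn; repeat first [apply: comp_add|apply: comp_mul|apply: comp_succ|apply:
  comp_entry|assumption|apply: comp_cst].
Qed.

(** A real is presented by its lower cut among the rationals.  Unlike a name, the cut does not
    depend on choices, and operations on reals act on it by first-order formulas. *)
Definition computableR (C : ctx) (r : idx C -> R) : Prop :=
  dec (ext C) (fun p => rat_real p.2 < r p.1).

End Rationals.
Arguments computableR {R} C _.

Section Cuts.
Variables (R : realType).
Implicit Types C : ctx.

Lemma Rcomp_weak C (r : idx C -> R) : computableR C r ->
  computableR (ext C) (fun p => r p.1).
Proof. by move=> cr; exact: (comp_reindex (reindex_lift (reindex_skip (reindex_refl
  C))) cr). Qed.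

Lemma dec_qlt C (r : idx C -> R) (a : idx C -> nat) : computableR C r -> computable C a ->
  dec C (fun i => rat_real R (a i) < r i).
Proof. exact: (@dec_subst C (fun i n => rat_real R n < r i)). Qed.

Lemma eq_Rcomp C (r s : idx C -> R) : r =1 s -> computableR C r -> computableR C s.
Proof. by move=> rs; apply: eq_dec => p; rewrite rs. Qed.

End Cuts.

(** Removes the last variable from a goal that does not depend on it: the function is
    evaluated at a dummy value 0 of that variable and the projections are reduced. *)
Ltac weaken :=
  lazymatch goal with |- ?P (ext ?C) ?F =>
    let i := fresh "i" in
    let G := constr:(fun i : idx C => ltac:(
      let b := eval cbn beta iota delta [fst snd] in (F (i, 0%N)) in exact b)) in
    first [ apply: (@comp_weak C G) | apply: (@dec_weak C G)
          | apply: (@Rcomp_weak _ C G) ] end.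

Ltac discrete_step := first [ assumption | lazymatch goal with
  | |- computable _ _ => first [ exact: comp_var | apply: comp_cst
    | apply: comp_succ | apply: comp_add | apply: comp_mul | apply: comp_exp2
    | apply: comp_entry | weaken ]
  | |- dec _ _ => first [ apply: dec_and | apply: dec_andb | apply: dec_or | apply:
    dec_not
    | apply: dec_ex | apply: dec_imp | apply: dec_all
    | apply: dec_leq | apply: dec_eqn | apply: dec_qlt | apply: dec_qsum
    | weaken ]
  | |- computableR _ _ => weaken end ].
Ltac decide_discrete := repeat discrete_step.

Section RealArithmetic.
Variables (R : realType).
Implicit Types C : ctx.

Lemma dec_lt C (r s : idx C -> R) : computableR C r -> computableR C s ->
  dec C (fun i => r i < s i).
Proof.
move=> cr cs; apply: (@eq_dec C (fun i => exists c, ~ (rat_real R c < r i) /\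
  rat_real R c < s i)).
  move=> i; split => [[c [/negP]]|/rat_real_dense[c /andP[rc cs']]].
    by rewrite -leNgt; exact: le_lt_trans.
  by exists c; split => //; apply/negP; rewrite -leNgt ltW.
decide_discrete.
Qed.

Lemma dec_le C (r s : idx C -> R) : computableR C r -> computableR C s ->
  dec C (fun i => r i <= s i).
Proof.
move=> cr cs; apply: eq_dec (dec_not (dec_lt cs cr)) => i.
by rewrite leNgt; split => /negP.
Qed.

Lemma Rcomp_q C (a : idx C -> nat) : computable C a ->
  computableR C (fun i => rat_real R (a i)).
Proof.
move=> ca; apply: (@eq_dec (ext C) (fun p => rat_real R p.2 + rat_real R 0 < rat_real R
  (a p.1) + rat_real R 0)).
  by move=> p; rewrite !rat_real0 !addr0.
decide_discrete.
Qed.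

Lemma Rcomp_add C (r s : idx C -> R) : computableR C r -> computableR C s ->
  computableR C (fun i => r i + s i).
Proof.
move=> cr cs; apply: (@eq_dec (ext C) (fun p => exists a b, rat_real R a < r p.1 /\
  rat_real R b < s p.1 /\
  rat_real R p.2 + rat_real R 0 < rat_real R a + rat_real R b)).
  move=> [i c] /=; rewrite rat_real0 addr0; split => [[a [b [ar [bs]]]]|h].
    by move=> /lt_trans; apply; rewrite ltrD.
  have [a /andP[a1 a2]] : exists a,
    rat_real R c - s i < rat_real R a < r i by apply: rat_real_dense; lra.
  have [b /andP[b1 b2]] : exists b,
    rat_real R c - rat_real R a < rat_real R b < s i by apply: rat_real_dense; lra.
  by exists a, b; do 2 split => //; lra.
decide_discrete.
Qed.

Lemma Rcomp_opp C (r : idx C -> R) : computableR C r -> computableR C (fun i => - r i).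
Proof.
move=> cr; apply: (@eq_dec (ext C) (fun p => exists a b, ~ rat_real R a < r p.1 /\
  rat_real R a + rat_real R 0 < rat_real R b + rat_real R 0 /\
    ~ (rat_real R 0 + rat_real R 0 < rat_real R p.2 + rat_real R b))).
  move=> [i c] /=; rewrite rat_real0; split => [[a [b [/negP ar [bs /negP]]]]|h].
    by move: ar bs; rewrite !addr0 -!leNgt => *; lra.
  have [b /andP[b1 b2]] : exists b,
    r i < rat_real R b < - rat_real R c by apply: rat_real_dense; lra.
  have [a /andP[a1 a2]] : exists a,
    r i < rat_real R a < rat_real R b by apply: rat_real_dense; lra.
  by exists a, b; split; [|split]; rewrite ?addr0 //; apply/negP; rewrite -leNgt; lra.
decide_discrete.
Qed.

Lemma Rcomp_sub C (r s : idx C -> R) : computableR C r -> computableR C s ->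
  computableR C (fun i => r i - s i).
Proof. by move=> cr cs; apply: Rcomp_add => //; exact: Rcomp_opp. Qed.

Lemma Rcomp_max C (r s : idx C -> R) : computableR C r -> computableR C s ->
  computableR C (fun i => Num.max (r i) (s i)).
Proof.
move=> cr cs; apply: (@eq_dec (ext C) (fun p => rat_real R p.2 < r p.1 \/ rat_real R
  p.2 < s p.1)).
  by move=> [i c] /=; rewrite lt_max; split => /orP.
decide_discrete.
Qed.

Lemma Rcomp_min C (r s : idx C -> R) : computableR C r -> computableR C s ->
  computableR C (fun i => Num.min (r i) (s i)).
Proof.
move=> cr cs; apply: (@eq_dec (ext C) (fun p => rat_real R p.2 < r p.1 /\
  rat_real R p.2 < s p.1)).
  by move=> [i c] /=; rewrite lt_min; split => /andP.
decide_discrete.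
Qed.

Lemma Rcomp_norm C (r : idx C -> R) : computableR C r -> computableR C (fun i => `|r i|).
Proof.
move=> cr; apply: (@eq_Rcomp R C (fun i => Num.max (r i) (- r i))).
  by move=> i; case: (lerP 0 (r i)) => h;
    [rewrite ger0_norm // max_l|rewrite ltr0_norm // max_r] => //; lra.
by apply: Rcomp_max => //; exact: Rcomp_opp.
Qed.

Lemma Rcomp_dyadic C (a b : idx C -> nat) : computable C a -> computable C b ->
  computableR C (fun i => (a i)%:R / 2 ^+ b i : R).
Proof.
move=> ca cb; apply: (@eq_dec (ext C) (fun p => (entry p.2 0 * 2 ^ b p.1 <
   a p.1 * (entry p.2 2).+1 + entry p.2 1 * 2 ^ b p.1)%N)).
  move=> [i c] /=; rewrite rat_realE ltr_pdivrMr // mulrAC ltr_pdivlMr ?exprn_gt0 //.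
  by rewrite mulrBl ltrBlDr -!natrX -!natrM -natrD ltr_nat.
by apply: dec_ltn; decide_discrete.
Qed.

Lemma Rcomp_pow2 C (a : idx C -> nat) : computable C a ->
  computableR C (fun i => 2 ^- a i : R).
Proof.
move=> ca; apply: eq_Rcomp (Rcomp_dyadic (comp_cst _ 1) ca) => i.
by rewrite mul1r.
Qed.

Lemma Rcomp_nat C (a : idx C -> nat) : computable C a ->
  computableR C (fun i => (a i)%:R : R).
Proof.
move=> ca; apply: eq_Rcomp (Rcomp_dyadic ca (comp_cst _ 0)) => i.
by rewrite expr0 divr1.
Qed.

Lemma Rcomp0 C : computableR C (fun=> 0 : R).
Proof. exact: (Rcomp_nat (comp_cst _ 0)). Qed.
Lemma Rcomp1 C : computableR C (fun=> 1 : R).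
Proof. exact: (Rcomp_nat (comp_cst _ 1)). Qed.

End RealArithmetic.

Ltac real_step := first [ assumption | lazymatch goal with
  | |- dec _ _ => first [ apply: dec_and | apply: dec_andb | apply: dec_or | apply:
    dec_not
    | apply: dec_ex | apply: dec_imp | apply: dec_all
    | apply: dec_leq | apply: dec_eqn | apply: dec_lt | apply: dec_le
    | weaken ]
  | |- computableR _ _ => first [ apply: Rcomp_q | apply: Rcomp_pow2 | apply: Rcomp_dyadic
    | apply: Rcomp_nat | apply: Rcomp0 | apply: Rcomp1
    | apply: Rcomp_add | apply: Rcomp_opp | apply: Rcomp_max | apply: Rcomp_min
    | apply: Rcomp_norm | weaken ]
  | |- computable _ _ => discrete_step end ].
Ltac decide_real := repeat real_step.

Section Sum.
Variables (R : realType).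
Implicit Types C : ctx.

Lemma entry_code s k : entry (code s) k = nth 0%N s k.
Proof. by rewrite /entry CodeSeq.codeK. Qed.

(** The cut of a finite sum in first-order terms: q lies below the sum when some coded list of
    rationals starts at 0, ends above q, and grows by less than r k at step k. *)
Lemma sum_cutP (r : nat -> R) (N : nat) (q : R) :
  (exists s, [/\ rat_real R (entry s 0) = 0, q < rat_real R (entry s N) &
     forall k, (k < N)%N -> rat_real R (entry s k.+1) < rat_real R (entry s k) + r k]) <->
  q < \sum_(k < N) r k.
Proof.
split=> [[s [s0 qs hs]]|].
  apply: (lt_le_trans qs) => {qs}; elim: N hs => [|N IHN] hs;
    first by rewrite big_ord0 s0.
  rewrite big_ord_recr /=; apply/ltW/(lt_le_trans (hs _ (ltnSn N))).
  by rewrite lerD2r; apply: IHN => k kN; apply: hs; rewrite ltnS ltnW.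
move=> qr_; suff [s [ss s0 qs hs]] : exists s : seq nat, [/\ size s = N.+1,
    rat_real R (nth 0%N s 0) = 0, q < rat_real R (nth 0%N s N) &
    forall k, (k < N)%N -> rat_real R (nth 0%N s k.+1) < rat_real R (nth 0%N s k) + r k].
  by exists (code s); rewrite !entry_code; split => // k; rewrite !entry_code; exact: hs.
elim: N q qr_ => [|N IHN] q.
  by rewrite big_ord0 => q0; exists [:: 0%N] => /=; rewrite rat_real0.
rewrite big_ord_recr /= => qs.
have /IHN[s [ss s0 sN hs]] : q - r N < \sum_(k < N) r k by lra.
have [c /andP[qc cs]] : exists c, q < rat_real R c < rat_real R (nth 0%N s N) + r N.
  by apply: rat_real_dense; lra.
exists (rcons s c); split; rewrite ?size_rcons ?ss //.
- by rewrite nth_rcons ss.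
- by rewrite nth_rcons ss ltnn eqxx.
move=> k; rewrite ltnS leq_eqVlt => /orP[/eqP->|kN].
  by rewrite !nth_rcons ss ltnn eqxx ltnSn.
by rewrite !nth_rcons ss !ltnS kN (ltnW kN); exact: hs.
Qed.

Lemma Rcomp_sum C (r : idx C -> nat -> R) (N : idx C -> nat) :
  computableR (ext C) (fun p => r p.1 p.2) -> computable C N ->
  computableR C (fun i => \sum_(k < N i) r i k).
Proof.
move=> cr cN; apply: (@eq_dec (ext C) (fun p => exists s,
  ~ (0 < rat_real R (entry s 0)) /\
   ~ (rat_real R (entry s 0) < 0) /\ rat_real R p.2 < rat_real R (entry s (N p.1)) /\
   forall k, (k < N p.1)%N -> rat_real R (entry s k.+1) < rat_real R (entry s k) + r
     p.1 k)).
  move=> [i c] /=; rewrite -sum_cutP;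
    split => [[s [/negP h1 [/negP h2 [h3 h4]]]]|[s [h1 h2 h3]]].
    by exists s; split => //; apply/le_anti; rewrite !leNgt h1 h2.
  by exists s; rewrite h1 ltxx.
have cr2 : computableR (ext (ext (ext C))) (fun p => r p.1.1.1 p.2).
  exact: comp_reindex (reindex_lift (reindex_lift
    (reindex_skip (reindex_skip (reindex_refl C))))) cr.
decide_real.
Qed.

End Sum.

(** * One-sided limits and the four classes *)

Section OneSided.
Variable R : realType.
Implicit Types (f g : R -> R) (x y eps d : R).

Lemma right_limP f x l : f y @[y --> x^'+] --> l <->
  forall eps, 0 < eps -> exists2 d, 0 < d & forall y, x < y < x + d -> `|l - f y| < eps.
Proof.
rewrite cvgrPdist_lt; split => h eps e0.
  have [d /= d0 hd] := h _ e0; exists d => // y /andP[xy yd].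
  by apply: hd => //=; rewrite ltr0_norm; lra.
have [d d0 hd] := h _ e0; exists d => //= y /= ; rewrite distrC => xyd xy.
by apply: hd; rewrite xy /=; move: xyd; rewrite gtr0_norm; lra.
Qed.

Lemma left_limP f x l : f y @[y --> x^'-] --> l <->
  forall eps, 0 < eps -> exists2 d, 0 < d & forall y, x - d < y < x -> `|l - f y| < eps.
Proof.
rewrite cvgrPdist_lt; split => h eps e0.
  have [d /= d0 hd] := h _ e0; exists d => // y /andP[xy yd].
  by apply: hd => //=; rewrite gtr0_norm; lra.
have [d d0 hd] := h _ e0; exists d => //= y /= ; rewrite distrC => xyd xy.
by apply: hd; rewrite xy andbT; move: xyd; rewrite ltr0_norm; lra.
Qed.

(** The decomposition by the total variation serves to prove that one-sided
    limits exist and that f is measurable; computing uses [rat_variation] instead. *)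
Lemma BV_monotone_diff f : bounded_variation 0 1 f -> exists g h : R -> R,
  [/\ {in `[0, 1] &, nondecreasing_fun g}, {in `[0, 1] &, nondecreasing_fun h} &
   {in `[0, 1], forall x, f x = g x - h x}].
Proof.
move=> bv; exists (fine \o pos_tv 0 f), (fine \o neg_tv 0 f); split.
- exact/fine_neg_tv_nondecreasing/bounded_variationN.
- exact: fine_neg_tv_nondecreasing.
- exact: bounded_variation_pos_neg_tvE.
Qed.

Lemma rlimP f x : bounded_variation 0 1 f -> 0 <= x < 1 -> forall eps, 0 < eps ->
  exists2 d, 0 < d & forall y, x < y < x + d -> `|rlim f x - f y| < eps.
Proof.
move=> /BV_monotone_diff[g [h [ndg ndh fE]]] /andP[x0 x1]; apply/right_limP.
have mono (k : R -> R) : {in `[0, 1] &, nondecreasing_fun k} -> cvg (k y @[y --> x^'+]).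
  move=> ndk; have x1b : (BRight x < BLeft (1 : R))%O by rewrite bnd_simp.
  apply/cvg_ex; eexists; apply: (nondecreasing_at_right_cvgr x1b).
    move=> y z; rewrite !in_itv /= => /andP[xy y1] /andP[xz z1]; apply: ndk;
    rewrite in_itv /=; lra.
  exists (k x) => _ /= [y + <-]; rewrite in_itv /= => /andP[xy y1].
  by apply: ndk; rewrite ?in_itv /=; lra.
have cf : cvg (f y @[y --> x^'+]).
  have c : cvg (g y - h y @[y --> x^'+]) by apply: is_cvgB; exact: mono.
  apply/cvg_ex; exists (lim (g y - h y @[y --> x^'+])).
  move/right_limP : c => c; apply/right_limP => eps /c[d d0 hd].
  exists (Num.min d (1 - x)) => [|y]; first by rewrite lt_min d0; lra.
  rewrite -ltrBlDl lt_min => /andP[xy /andP[yd y1]].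
  by rewrite fE ?in_itv /=; [apply: hd|]; lra.
exact: cf.
Qed.

Lemma llimP f x : bounded_variation 0 1 f -> 0 < x <= 1 -> forall eps, 0 < eps ->
  exists2 d, 0 < d & forall y, x - d < y < x -> `|llim f x - f y| < eps.
Proof.
move=> /BV_monotone_diff[g [h [ndg ndh fE]]] /andP[x0 x1]; apply/left_limP.
have mono (k : R -> R) : {in `[0, 1] &, nondecreasing_fun k} -> cvg (k y @[y --> x^'-]).
  move=> ndk; apply: nondecreasing_at_left_is_cvgr; near=> z.
    have z0 : 0 < z by near: z; exact: nbhs_left_gt.
    move=> u v; rewrite !in_itv /= => /andP[xy y1] /andP[xz z1]; apply: ndk;
    rewrite in_itv /=; lra.
  have z0 : 0 < z by near: z; exact: nbhs_left_gt.
  exists (k x) => _ /= [y + <-]; rewrite in_itv /= => /andP[xy y1].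
  by apply: ndk; rewrite ?in_itv /=; lra.
have cf : cvg (f y @[y --> x^'-]).
  have c : cvg (g y - h y @[y --> x^'-]) by apply: is_cvgB; exact: mono.
  apply/cvg_ex; exists (lim (g y - h y @[y --> x^'-])).
  move/left_limP : c => c; apply/left_limP => eps /c[d d0 hd].
  exists (Num.min d x) => [|y]; first by rewrite lt_min d0; lra.
  rewrite ltrBlDr -ltrBlDl lt_min => /andP[/andP[yd y1] xy].
  by rewrite fE ?in_itv /=; [apply: hd|]; lra.
exact: cf.
Unshelve. all: by end_near. Qed.

Lemma mean_intermediate f : mean_BV f -> intermediate_BV f.
Proof.
move=> [bv m]; split => // x x01; rewrite m //.
by rewrite ge_min le_max; case: (lerP (llim f x) (rlim f x)) => ?; apply/andP; split;
  apply/orP; lra.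
Qed.

Lemma normalised_intermediate f : normalised_BV f -> intermediate_BV f.
Proof.
move=> [bv _ m]; split => // x /andP[x0 x1].
by rewrite ge_min le_max m ?lexx ?orbT //; lra.
Qed.

(** A relatively open set that is not empty and lies near an interior point x contains points
    other than x, so values close to f x are taken at points different from x. *)
Lemma quasi_continuous_near f x eps d : quasi_continuous f -> 0 < x < 1 ->
  0 < eps -> 0 < d ->
  exists2 y, x - d < y < x \/ x < y < x + d & `|f x - f y| < eps.
Proof.
move=> qc x01 e0 d0.
pose r := Num.min d (Num.min x (1 - x)).
have r0 : 0 < r by rewrite /r !lt_min d0; lra.
have rd : r <= d by rewrite /r ge_min lexx.
have rx : r <= x by rewrite /r !ge_min lexx !orbT.
have r1 : r <= 1 - x by rewrite /r !ge_min lexx !orbT.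
have ro : rel_open `]x - r, x + r[%classic.
  exists `]x - r, x + r[%classic; first exact: interval_open.
  apply/seteqP; split => [y|y []//] /=; rewrite !in_itv /= => /andP[? ?].
  by split => //; rewrite ?in_itv /=; lra.
have [||G [[V oV ->] [y [Vy y01]] sub close]] := qc x eps _ _ e0 ro; first by lra.
  by rewrite /= in_itv /=; lra.
have far z : (V `&` `[0, 1]) z -> z != x -> exists2 y,
  x - d < y < x \/ x < y < x + d & `|f x - f y| < eps.
  move=> Gz zx; exists z; last exact: close.
  have := sub z Gz; rewrite /= in_itv /= => /andP[? ?].
  by have [?|?|zE] := ltgtP x z; [right|left|rewrite zE eqxx in zx]; lra.
have [yx|nyx] := eqVneq y x; last exact: far nyx.
have /nbhs_ballP[e /= e1 he] : nbhs x V by apply: open_nbhs_nbhs; rewrite -yx.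
pose h := Num.min e r / 2.
have m0 : 0 < Num.min e r by rewrite lt_min e1.
have me : Num.min e r <= e by rewrite ge_min lexx.
have mr : Num.min e r <= r by rewrite ge_min lexx orbT.
apply: (far (x + h)); last by rewrite -subr_eq0 addrAC subrr add0r gt_eqF // /h; lra.
split; last by rewrite /= in_itv /= /h; lra.
by apply: he; rewrite /ball /= ltr0_norm /h; lra.
Qed.

(** A value outside the interval spanned by the one-sided limits would be isolated from the
    values at neighbouring points. *)
Lemma quasi_continuous_intermediate f : quasi_continuous_BV f -> intermediate_BV f.
Proof.
move=> [bv qc]; split => // x x01.
have [xr xl] : 0 <= x < 1 /\ 0 < x <= 1 by lra.
set l := llim f x; set r := rlim f x.
have close eps : 0 < eps -> `|f x - l| < eps \/ `|f x - r| < eps.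
  move=> e0; have e2 : 0 < eps / 2 by lra.
  have [d1 d10 h1] := rlimP bv xr e2; have [d2 d20 h2] := llimP bv xl e2.
  have d0 : 0 < Num.min d1 d2 by rewrite lt_min d10.
  have [m1 m2] : Num.min d1 d2 <= d1 /\ Num.min d1 d2 <= d2.
    by rewrite !ge_min !lexx orbT.
  have [y [yx|yx] fy] := quasi_continuous_near qc x01 e2 d0.
    left; apply: (le_lt_trans (ler_distD (f y) _ _)); rewrite (splitr eps) ltrD //.
    by rewrite distrC; apply: h2; lra.
  right; apply: (le_lt_trans (ler_distD (f y) _ _)); rewrite (splitr eps) ltrD //.
  by rewrite distrC; apply: h1; lra.
apply/andP; split; rewrite leNgt; apply/negP => lt_f.
  have ml : Num.min l r <= l by rewrite ge_min lexx.
  have mr : Num.min l r <= r by rewrite ge_min lexx orbT.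
  have /close[] : 0 < Num.min l r - f x by rewrite subr_gt0.
    by rewrite ltr_norml; lra.
  by rewrite ltr_norml; lra.
have ml : l <= Num.max l r by rewrite le_max lexx.
have mr : r <= Num.max l r by rewrite le_max lexx orbT.
have /close[] : 0 < f x - Num.max l r by rewrite subr_gt0.
  by rewrite ltr_norml; lra.
by rewrite ltr_norml; lra.
Qed.

(** The two rationals are taken close to x on both sides, where f is close to its one-sided
    limits, and f x lies between these. *)
Lemma rational_sides f x a b eps : intermediate_BV f -> 0 < x < 1 -> a < x < b ->
  0 < eps ->
  exists u v, [/\ Num.max a 0 < rat_real R u < x, x < rat_real R v < Num.min b 1 &
    (f (rat_real R u) - eps <= f x <= f (rat_real R v) + eps) \/
    (f (rat_real R v) - eps <= f x <= f (rat_real R u) + eps)].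
Proof.
move=> [bv inter] x01 axb e0.
have [xr xl] : 0 <= x < 1 /\ 0 < x <= 1 by lra.
have [d1 d10 h1] := rlimP bv xr e0; have [d2 d20 h2] := llimP bv xl e0.
have [u /andP[u1 u2]] : exists u, Num.max (Num.max a 0) (x - d2) < rat_real R u < x.
  by apply: rat_real_dense; rewrite !gt_max; lra.
have [v /andP[v1 v2]] : exists v, x < rat_real R v < Num.min (Num.min b 1) (x + d1).
  by apply: rat_real_dense; rewrite !lt_min; lra.
move: u1 v2; rewrite gt_max lt_min => /andP[u0 u1] /andP[v0 v2].
exists u, v; split; rewrite ?u0 ?v0 ?u2 ?v1 //.
have /ltW := h1 _ (introT andP (conj v1 v2));
  have /ltW := h2 _ (introT andP (conj u1 u2)).
rewrite !ler_norml; have := inter x x01.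
by case: (lerP (llim f x) (rlim f x)) => ? *; [left|right]; lra.
Qed.

(** The point y lies between values at nearby rationals up to eps; the endpoints 0 and 1 are
    rational themselves. *)
Lemma rational_bounds f a b lo hi : intermediate_BV f ->
  (forall c, 0 <= rat_real R c <= 1 -> a < rat_real R c < b ->
    lo <= f (rat_real R c) <= hi) ->
  forall y, 0 <= y <= 1 -> a < y < b -> lo <= f y <= hi.
Proof.
move=> fi hq y y01 ayb.
have rat01 : exists c0 c1, rat_real R c0 = 0 /\ rat_real R c1 = 1.
  have [c0 e0] := rat_of_nat_surj 0; have [c1 e1] := rat_of_nat_surj 1.
  by exists c0, c1; rewrite /rat_real e0 e1 rmorph0 rmorph1.
have [c0 [c1 [q0 q1]]] := rat01.
have [y0|y0] := eqVneq y 0; first by rewrite y0 -q0; apply: hq; rewrite q0; lra.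
have [y1|y1] := eqVneq y 1; first by rewrite y1 -q1; apply: hq; rewrite q1; lra.
have y01' : 0 < y < 1 by rewrite !lt_neqAle eq_sym y0 y1.
suff h eps : 0 < eps -> lo - eps <= f y <= hi + eps.
  by apply/andP; split; apply/ler_addgt0Pr => e /h; lra.
move=> e0; have [u [v []]] := rational_sides fi y01' ayb e0.
rewrite gt_max lt_min => /andP[/andP[u1 u2] u3] /andP[v1 /andP[v2 v3]].
have hu : lo <= f (rat_real R u) <= hi by apply: hq; lra.
have hv : lo <= f (rat_real R v) <= hi by apply: hq; lra.
by case=> *; lra.
Qed.
End OneSided.

(** * Variation along chains of rationals *)

Section Variation.
Variable R : realType.
Implicit Types (f : R -> R) (x y : R).

(** The code s lists the chain, N is the number of its steps; entries after the N-th are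
    ignored. *)
Definition chain (s N : nat) x : Prop :=
  [/\ rat_real R (entry s 0) = 0, rat_real R (entry s N) <= x &
   forall k, (k < N)%N -> rat_real R (entry s k) <= rat_real R (entry s k.+1)].

Definition chain_sum f (s N : nat) x : R :=
  \sum_(k < N) `|f (rat_real R (entry s k.+1)) - f (rat_real R (entry s k))| + `|f x -
    f (rat_real R (entry s N))|.

Definition rat_variation f x : R :=
  sup [set v | exists s N, chain s N x /\ v = chain_sum f s N x].

Lemma le_of_steps (y : nat -> R) N : (forall k, (k < N)%N -> y k <= y k.+1) ->
  forall i j, (i <= j <= N)%N -> y i <= y j.
Proof.
move=> hy i; elim=> [|j IHj]; first by rewrite leqn0 => /andP[/eqP->].
case/andP; rewrite leq_eqVlt => /orP[/eqP->//|ij jN].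
by apply: le_trans (hy _ jN); apply: IHj; rewrite -ltnS ij ltnW.
Qed.

Lemma chain_itv s N x k : chain s N x -> (k <= N)%N -> 0 <= rat_real R (entry s k) <= x.
Proof.
move=> [s0 sN hs] kN; have mono := le_of_steps hs.
rewrite -{1}s0 (mono 0%N k) ?kN //=; apply: le_trans sN; apply: mono.
by rewrite kN leqnn.
Qed.

(** Steps may be trivial, while partitions of an interval are strictly increasing; additivity of
    the total variation avoids removing repetitions. *)
Lemma TV_sum f (y : nat -> R) N :
  (forall k, (k < N)%N -> y k <= y k.+1) ->
  ((\sum_(k < N) `|f (y k.+1) - f (y k)|)%:E <= total_variation (y 0%N) (y N) f)%E.
Proof.
elim: N => [|N IHN] hy; first by rewrite big_ord0 total_variationxx.
have yN : y 0%N <= y N.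
  by apply: (le_of_steps (N := N)) => [k kN|]; [apply: hy; exact: ltnW|rewrite leqnn].
rewrite big_ord_recr /= EFinD (total_variationD f yN (hy _ (ltnSn N))).
apply: leeD; first by apply: IHN => k kN; apply: hy; exact: ltnW.
by apply: total_variation_ge; exact: hy.
Qed.

Lemma chain_sum_ubound f x : bounded_variation 0 1 f -> 0 <= x <= 1 ->
  exists B, forall s N, chain s N x -> chain_sum f s N x <= B.
Proof.
move=> bv /andP[x0 x1]; have /bounded_variationP - /(_ x0) fin := bounded_variationl x0
  x1 bv.
exists (fine (total_variation 0 x f)) => s N [s0 sN hs].
rewrite -lee_fin fineK //.
pose y k := if (k <= N)%N then rat_real R (entry s k) else x.
have hy k : (k < N.+1)%N -> y k <= y k.+1.
  rewrite ltnS /y => kN; rewrite kN; case: ltnP => [|Nk]; first exact: hs.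
  by rewrite (_ : k = N) //; apply/eqP; rewrite eqn_leq kN.
have := TV_sum f hy; rewrite /y ltnn leq0n s0 big_ord_recr /= leqnn ltnn; apply: le_trans.
rewrite /chain_sum lee_fin lerD2r le_eqVlt; apply/orP; left; apply/eqP.
by apply: eq_bigr => k _; rewrite ltn_ord ltnW.
Qed.

Lemma lt_rat_variation f x q : bounded_variation 0 1 f -> 0 <= x <= 1 ->
  q < rat_variation f x <-> exists s N, chain s N x /\ q < chain_sum f s N x.
Proof.
move=> bv x01; have [B hB] := chain_sum_ubound bv x01.
split=> [/sup_gt[|v [s [N [c ->]]] qv]|[s [N [c qs]]]].
- exists (chain_sum f 0 0 x); exists 0%N, 0%N; split => //.
  by split => //; rewrite /entry /= rat_real0 //; case/andP: x01.
- by exists s, N.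
apply: (lt_le_trans qs); apply: ub_le_sup; last by exists s, N.
by exists B => _ [t [M [ct ->]]]; exact: hB.
Qed.

(** The triangle inequality is almost an equality when w is almost between a and d. *)
Lemma almost_between (a w d e : R) : 0 <= e ->
  (a - e / 2 <= w <= d + e / 2) \/ (d - e / 2 <= w <= a + e / 2) ->
  `|w - a| + `|d - w| <= `|d - a| + e.
Proof. by move=> e0 [] h; do 3 case: ler0P => ?; lra. Qed.

(** The point x need not be rational and so may not occur in a chain; passing instead through
    u and v on its two sides loses at most eps.  When x is c or y, no new point is needed. *)
Lemma rational_insert f c x y eps : intermediate_BV f -> 0 <= rat_real R c <= x ->
  x <= y <= 1 -> 0 < eps ->
  exists u v, [/\ rat_real R c <= rat_real R u <= x,
    rat_real R u <= rat_real R v <= y &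
    `|f x - f (rat_real R c)| + `|f y - f x| <=
    `|f (rat_real R u) - f (rat_real R c)| + `|f (rat_real R v) - f (rat_real R u)| +
      `|f y - f (rat_real R v)| + eps].
Proof.
move=> fi cx xy e0.
have [xc|xc] := eqVneq x (rat_real R c).
  exists c, c; split; [by lra|by lra|].
  by rewrite -xc !subrr normr0; lra.
have [yx|yx] := eqVneq x y.
  exists c, c; split; [by lra|by lra|].
  by rewrite -yx !subrr normr0; lra.
have {}xc : rat_real R c < x by rewrite lt_neqAle eq_sym xc; lra.
have {}yx : x < y by rewrite lt_neqAle yx; lra.
have e2 : 0 < eps / 2 by lra.
have [x01 cxy] : 0 < x < 1 /\ rat_real R c < x < y by lra.
have [u [v [+ + h]]] := rational_sides fi x01 cxy e2.
rewrite gt_max lt_min => /andP[/andP[u1 u2] u3] /andP[v1 /andP[v2 v3]].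
exists u, v; split; [by lra|by lra|].
have near_triangle := almost_between (ltW e0) h.
have left_triangle := ler_normD (f x - f (rat_real R u)) (f (rat_real R u) - f
  (rat_real R c)).
have right_triangle := ler_normD (f y - f (rat_real R v)) (f (rat_real R v) - f x).
by move: left_triangle right_triangle; rewrite !addrA !subrK; lra.
Qed.

(** A chain for x that is nearly optimal, extended by the two rationals around x, is a chain
    for y. *)
Lemma rat_variation_step f x y : intermediate_BV f -> 0 <= x -> x <= y -> y <= 1 ->
  rat_variation f x + `|f y - f x| <= rat_variation f y.
Proof.
move=> fi x0 xy y1; have [bv _] := fi.
have [x01 y01] : 0 <= x <= 1 /\ 0 <= y <= 1 by lra.
rewrite leNgt; apply/negP => lt_y.
set W := rat_variation f in lt_y.
have : W y - `|f y - f x| < W x by lra.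
have [e eE] : exists e, e = W x - (W y - `|f y - f x|) by eexists.
move=> lt_x.
have /lt_rat_variation - /(_ bv x01)[s [N [cs hs]]] : W x - e / 2 < W x by lra.
have e2 : 0 < e / 2 by lra.
have xy1 : x <= y <= 1 by rewrite xy.
have [u [v [hu hv hi]]] := rational_insert fi (chain_itv cs (leqnn N)) xy1 e2.
pose t := code (rcons (rcons (mkseq (entry s) N.+1) u) v).
have tk k : (k <= N)%N -> entry t k = entry s k.
  move=> kN; rewrite /t entry_code nth_rcons size_rcons size_mkseq ltnS (leqW kN).
  by rewrite nth_rcons size_mkseq ltnS kN nth_mkseq.
have tu : entry t N.+1 = u.
  by rewrite /t entry_code nth_rcons size_rcons size_mkseq ltnSn nth_rcons size_mkseq
    ltnn eqxx.
have tv : entry t N.+2 = v.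
  by rewrite /t entry_code nth_rcons size_rcons size_mkseq ltnn eqxx.
have ct : chain t N.+2 y.
  have [s0 sN hs'] := cs; split; [by rewrite tk|by rewrite tv; lra|].
  move=> k; rewrite !ltnS leq_eqVlt => /orP[/eqP->|]; first by rewrite tu tv; lra.
  rewrite ltnS leq_eqVlt => /orP[/eqP->|kN]; first by rewrite tu tk //; lra.
  by rewrite !tk ?(ltnW kN) //; exact: hs'.
have : W y < chain_sum f t N.+2 y.
  rewrite /chain_sum !big_ord_recr /= tu tv tk //.
  under eq_bigr => k _ do rewrite tk // tk ?(ltnW (ltn_ord k)) //.
  by move: hs; rewrite /chain_sum; lra.
move=> hW; have : W y < W y by apply/lt_rat_variation => //; exists t, N.+2.
by rewrite ltxx.
Qed.

End Variation.

(** * Names of reals and values of a realized function *)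

Section Names.
Variable R : realType.
Implicit Types (u : nat -> nat) (r : R).

(** Programs must be defined on all sequences, so one that is no name gets the value 0. *)
Definition val u : R :=
  if `[< fast_cauchy u >] then lim (rat_real R (u n) @[n --> \oo]) else 0.

Lemma val_represents u r : represents u r -> val u = r.
Proof. by move=> [fu ur]; rewrite /val asboolT //; exact: cvg_lim. Qed.

Lemma fast_cauchyE u : fast_cauchy u <->
  forall n i, `|rat_real R (u n) - rat_real R (u (n + i)%N)| < 2 ^- n.
Proof.
suff E n i : (`|rat_of_nat (u n) - rat_of_nat (u (n + i)%N)| < 2 ^- n) =
    (`|rat_real R (u n) - rat_real R (u (n + i)%N)| < 2 ^- n).
  by split => h n i; [rewrite -E|rewrite E]; exact: h.
rewrite /rat_real -rmorphB /= -ratr_norm -(ltr_rat R).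
by rewrite fmorphV rmorphXn /= ratr_nat.
Qed.

Lemma pow2_small (e : R) : 0 < e -> exists N, forall n, (N <= n)%N -> 2 ^- n < e.
Proof.
move=> e0; have [N _ hN] := near_infty_natSinv_expn_lt (PosNum e0).
by exists N => n Nn; have := hN n Nn; rewrite /= div1r.
Qed.

Lemma fast_cauchy_cvg u : fast_cauchy u -> exists2 r : R, represents u r &
  forall n, `|r - rat_real R (u n)| <= 2 ^- n.
Proof.
move=> fu; have /fast_cauchyE hu := fu.
have : cvg (rat_real R (u n) @[n --> \oo]).
  apply/cauchy_cvgP/cauchy_exP => eps e0; have [N hN] := pow2_small e0.
  exists (rat_real R (u N)), N => // n /= Nn; rewrite /ball /=.
  by rewrite -(subnKC Nn); apply: lt_trans (hu _ _) (hN _ _).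
move/cvg_ex => [r ur]; exists r => //= n.
apply/ler_addgt0Pr => e e0.
move/cvgrPdist_lt : ur => /(_ _ e0)[N _ hN].
have := hu n N; have := hN (n + N)%N (leq_addl _ _) => /= h1 h2.
rewrite (le_trans (ler_distD (rat_real R (u (n + N)%N)) _ _)) // addrC lerD //;
  apply/ltW => //.
by rewrite distrC.
Qed.

Definition name r (n : nat) : nat := least (fun c => `|rat_real R c - r| < 2 ^- n.+1).

Lemma nameP r n : `|rat_real R (name r n) - r| < 2 ^- n.+1.
Proof.
apply: (leastP (P := fun c => `|rat_real R c - r| < 2 ^- n.+1)).
have e0 : 0 < 2 ^- n.+1 :> R by rewrite invr_gt0 exprn_gt0.
have [c /andP[c1 c2]] : exists c,
  r < rat_real R c < r + 2 ^- n.+1 by apply: rat_real_dense; lra.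
by exists c; rewrite ltr_norml; lra.
Qed.

(** Two approximations within 2^-(n+1) of r are less than 2^-n apart. *)
Lemma represents_name r : represents (name r) r.
Proof.
split.
  apply/fast_cauchyE => n i; apply: (le_lt_trans (ler_distD r _ _)).
  have -> : 2 ^- n = 2 ^- n.+1 + 2 ^- n.+1 :> R.
    by rewrite exprS invfM; lra.
  apply: ltrD; first exact: nameP.
  rewrite distrC; apply: lt_le_trans (nameP _ _) _.
  by rewrite lef_pV2 ?posrE ?exprn_gt0 // ler_eXn2l ?ltr1n // ltnS leq_addr.
apply/cvgrPdist_lt => e e0; have [N hN] := pow2_small e0.
exists N => // n /= Nn; rewrite distrC; apply: lt_trans (nameP _ _) (hN _ _).
exact: leqW.
Qed.

End Names.

Section Oracle.
Variable R : realType.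

(** The type-2 argument of C realizes f; its first entry is the place at which the value of the
    realizer is read, as in [op_obj]. *)
Definition oracle (C : ctx) (f : idx C -> R -> R) : Prop :=
  forall i, exists2 phi, realizes phi (f i) &
    fn i = (fun g : nat -> nat => phi (fun k => g k.+1) (g 0%N)).
Arguments oracle : clear implicits.

(** A realizer says nothing about points outside the unit interval, while the programs quantify
    over all rationals; arguments are projected to the interval. *)
Definition clamp (x : R) : R := Num.max 0 (Num.min x 1).

Lemma clamp_itv x : 0 <= clamp x <= 1.
Proof. by rewrite /clamp le_max lexx ge_max ge_min lexx orbT ler01. Qed.

Lemma clamp_id x : 0 <= x <= 1 -> clamp x = x.
Proof. by move=> /andP[x0 x1]; rewrite /clamp min_l // max_r. Qed.

Lemma oracle_ext C f : oracle C f -> oracle (ext C) (fun p => f p.1).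
Proof. by move=> of_ [i n]; exact: of_. Qed.

Lemma comp_at C D (pi : idx D -> idx C) (u : idx C -> nat -> nat) (a : idx D -> nat) :
  reindex C D pi -> computable (ext C) (fun p => u p.1 p.2) -> computable D a ->
  computable D (fun i => u (pi i) (a i)).
Proof.
move=> hpi cu; exact: (@comp_subst D (fun i => u (pi i)) a
  (comp_reindex (reindex_lift hpi) cu)).
Qed.

Lemma Rcomp_clamp C (r : idx C -> R) : computableR C r ->
  computableR C (fun i => clamp (r i)).
Proof. move=> cr; rewrite /clamp; decide_real. Qed.

(** For a name u of r, a rational lies below r exactly when it lies 2^-m below u m for
    some m. *)
Lemma Rcomp_val C (u : idx C -> nat -> nat) : computable (ext C) (fun p => u p.1 p.2) ->
  computableR C (fun i => val R (u i)).
Proof.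
move=> cu; apply: (@eq_dec (ext C) (fun p =>
  ((forall n i, `|rat_real R (u p.1 n) - rat_real R (u p.1 (n + i)%N)| < 2 ^- n) /\
    exists m, rat_real R p.2 + 2 ^- m < rat_real R (u p.1 m)) \/
  (~ (forall n i, `|rat_real R (u p.1 n) - rat_real R (u p.1 (n + i)%N)| < 2 ^- n) /\
    rat_real R p.2 < 0))).
  move=> [i c] /=; rewrite -(propext (fast_cauchyE R (u i))).
  have [fu|nfu] := pselect (fast_cauchy (u i)); last first.
    by rewrite /val asboolF //; split => [[[]//|[]//]|]; right.
  have [r ur hr] := fast_cauchy_cvg R fu; rewrite (val_represents ur).
  split => [[[_ [m hm]]|[]//]|cr].
    by have := hr m; rewrite ler_norml; lra.
  left; split => //; have d0 : 0 < (r - rat_real R c) / 2 by lra.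
  have [m /(_ m (leqnn m)) hm] := pow2_small d0; exists m.
  by have := hr m; rewrite ler_norml; lra.
have sk1 := reindex_skip (reindex_refl C); have sk2 := reindex_skip sk1.
have sk3 := reindex_skip sk2.
decide_real; by [apply: (comp_at sk2 cu); decide_real|apply: (comp_at sk3 cu);
  decide_real].
Qed.

End Oracle.

Section Functionals.
Variable R : realType.
Implicit Types (C : ctx).

Lemma comp_name C (r : idx C -> R) : computableR C r ->
  computable (ext C) (fun p => name (r p.1) p.2).
Proof.
move=> cr; apply: (comp_least (C := ext C)
  (P := fun p c => `|rat_real R c - r p.1| < 2 ^- p.2.+1)).
decide_real.
Qed.

(** The realizer is fed with a name found by search, and the name that it returns is turned
    back into a cut.  The value does not depend on the name that was chosen. *)
Lemma Rcomp_oracle C f (r : idx C -> R) : @oracle R C f -> computableR C r ->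
  (forall i, 0 <= r i <= 1) -> computableR C (fun i => f i (r i)).
Proof.
move=> of_ cr r01.
pose u i n := fn i (fun k => if `[< k = 0%N >] then n else name (r i) k.-1).
apply: (@eq_Rcomp R C (fun i => val R (u i))).
  move=> i; have [phi hphi fnE] := of_ i.
  apply: val_represents; rewrite (_ : u i = phi (name (r i))).
    by apply: hphi => //; exact: represents_name.
  apply/funext => n; rewrite /u fnE; congr (phi _ _); last by rewrite asboolT.
  by apply/funext => k; rewrite asboolF.
apply: Rcomp_val; apply: (comp_type2 (C := ext C) (Psi := fun p => fn p.1)
  (g := fun p k => if `[< k = 0%N >] then p.2 else name (r p.1) k.-1) (j := (fnpos
    C).+1)).
- exact: fnpos_lt.
- by move=> i; exact: nth_fnpos.
apply: comp_if; [by decide_real|by decide_real|].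
apply: (comp_at (C := C) (D := ext (ext C)) (pi := fun p => p.1.1)
  (u := fun i k => name (r i) k) (a := fun p => p.2.-1)).
- exact: reindex_skip (reindex_skip (reindex_refl C)).
- exact: comp_name.
- exact: comp_pred (comp_var _).
Qed.

Lemma Rcomp_fclamp C f (r : idx C -> R) : @oracle R C f -> computableR C r ->
  computableR C (fun i => f i (clamp (r i))).
Proof.
by move=> of_ cr; apply: Rcomp_oracle of_ (Rcomp_clamp cr) _ => i; exact: clamp_itv.
Qed.

Lemma Rcomp_variation C f (r : idx C -> R) : @oracle R C f -> computableR C r ->
  (forall i, intermediate_BV (f i)) -> (forall i, 0 <= r i <= 1) ->
  computableR C (fun i => rat_variation (f i) (r i)).
Proof.
move=> of_ cr bvf r01.
pose y s k := rat_real R (entry s k).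
apply: (@eq_dec (ext C) (fun p => exists s N, (~ (0 < y s 0%N) /\ ~ (y s 0%N < 0) /\
   y s N <= r p.1 /\ forall k, (k < N)%N -> y s k <= y s k.+1) /\
   rat_real R p.2 < \sum_(k < N) `|f p.1 (clamp (y s k.+1)) - f p.1 (clamp (y s k))| +
     `|f p.1 (clamp (r p.1)) - f p.1 (clamp (y s N))|)).
  move=> [i c] /=; have [bv _] := bvf i.
  rewrite (lt_rat_variation _ bv (r01 i)).
  have sumE s N : chain s N (r i) ->
     \sum_(k < N) `|f i (clamp (y s k.+1)) - f i (clamp (y s k))| +
     `|f i (clamp (r i)) - f i (clamp (y s N))| = chain_sum (f i) s N (r i).
    move=> cs; have cl k : (k <= N)%N -> clamp (y s k) = y s k.
      by move=> kN; apply: clamp_id; have := chain_itv cs kN; have := r01 i;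
        rewrite /y; lra.
    rewrite (clamp_id (r01 i)) cl // /chain_sum; congr (_ + _).
    by apply: eq_bigr => k _; rewrite !cl // ltnW.
  split=> -[s [N [cs qs]]]; exists s, N.
    have ch : chain s N (r i).
      case: cs => /negP s0 [/negP s0' [sN hs]]; split => //.
      by apply/le_anti; rewrite !leNgt s0 s0'.
    by rewrite -sumE.
  rewrite sumE //; split => //; case: cs => s0 sN hs.
  by rewrite /y s0 ltxx.
have of3 : @oracle R (ext (ext (ext C))) (fun p => f p.1.1.1).
  exact: oracle_ext (oracle_ext (oracle_ext of_)).
have of4 : @oracle R (ext (ext (ext (ext C)))) (fun p => f p.1.1.1.1).
  exact: oracle_ext of3.
rewrite /y; apply: dec_ex; apply: dec_ex; apply: dec_and; first by decide_real.
apply: dec_lt; first by decide_real.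
apply: Rcomp_add.
  apply: (Rcomp_sum (C := ext (ext (ext C))) (r := fun p k =>
   `|f p.1.1.1 (clamp (rat_real R (entry p.1.2 k.+1))) - f p.1.1.1 (clamp (rat_real R
     (entry p.1.2 k)))|)); last by decide_real.
  by apply: Rcomp_norm; apply: Rcomp_sub; apply: (Rcomp_fclamp of4); decide_real.
by apply: Rcomp_norm; apply: Rcomp_sub; apply: (Rcomp_fclamp of3); decide_real.
Qed.
End Functionals.

(** * A point where the function varies slowly *)

Section SlowPoint.
Variable R : realType.
Implicit Types (f W : R -> R) (x t : R).

(** The n-th cells have length 4^-n, which is written with exponent n + n of 2. *)
Definition grid (A n : nat) : R := A%:R / 2 ^+ (n + n).

(** Cut the A-th interval of length 4^-n into quarters 0, 1, 2, 3: the function W grows no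
    more on quarter 1 than on quarter 2. *)
Definition flatter W (A n : nat) : Prop :=
  W (clamp (grid (4 * A + 2) n.+1)) - W (clamp (grid (4 * A + 1) n.+1)) <=
  W (clamp (grid (4 * A + 3) n.+1)) - W (clamp (grid (4 * A + 2) n.+1)).

Definition cell W : nat -> nat :=
  nat_rect (fun=> nat) 0%N (fun n A => 4 * A + if `[< flatter W A n >] then 1 else 2)%N.

Definition slow_point W : R := sup [set grid (cell W n) n | n in setT].

Lemma gridS A j n : grid (4 * A + j) n.+1 = grid A n + j%:R * (2 ^- (n + n) / 4).
Proof.
rewrite /grid addSn addnS !exprS natrD natrM; field.
by rewrite expf_neq0.
Qed.

Section Nested.
Variable W : R -> R.
Hypothesis ndW : nondecreasing01 W.
Let a n := grid (cell W n) n.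
Let u n : R := 2 ^- (n + n).

Lemma cell_width_gt0 n : 0 < u n. Proof. by rewrite invr_gt0 exprn_gt0. Qed.

Lemma cell_widthS n : u n.+1 = u n / 4.
Proof. by rewrite /u addSn addnS !exprS; field; rewrite expf_neq0. Qed.

Lemma cell_step n : exists2 j : R, a n.+1 = a n + j * (u n / 4) & j = 1 \/ j = 2.
Proof.
rewrite /a /= gridS; case: asboolP => _; first by exists 1; [|left].
by exists 2; [|right].
Qed.

Lemma cell_itv n : 0 <= a n /\ a n + u n <= 1.
Proof.
elim: n => [|n [IH0 IH1]]; first by rewrite /a /grid /u /= expr0; lra.
have := cell_width_gt0 n; rewrite cell_widthS.
by have [j -> [->|->]] := cell_step n => ?; lra.
Qed.

(** Quarters 1 and 2 are disjoint, so the smaller of the two increments is at most half of the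
    increment on the whole cell. *)
Lemma cell_halve n : W (a n.+1 + u n.+1) - W (a n.+1) <= (W (a n + u n) - W (a n)) / 2.
Proof.
have [a0 a1] := cell_itv n; have u0 := cell_width_gt0 n; rewrite cell_widthS /a /=.
case: asboolP; rewrite /flatter !gridS -/(a n) -/(u n) !clamp_id; try by lra.
  move=> h.
  have h01 : W (a n) <= W (a n + 1 * (u n / 4)) by apply: ndW; lra.
  have h34 : W (a n + 3 * (u n / 4)) <= W (a n + u n) by apply: ndW; lra.
  by rewrite (_ : a n + 1 * (u n / 4) + u n / 4 = a n + 2 * (u n / 4)); lra.
move=> /negP; rewrite -ltNge => h.
have h01 : W (a n) <= W (a n + 1 * (u n / 4)) by apply: ndW; lra.
have h34 : W (a n + 3 * (u n / 4)) <= W (a n + u n) by apply: ndW; lra.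
by rewrite (_ : a n + 2 * (u n / 4) + u n / 4 = a n + 3 * (u n / 4)); lra.
Qed.

Lemma cell_small n : W (a n + u n) - W (a n) <= (W 1 - W 0) / 2 ^+ n.
Proof.
elim: n => [|n IHn].
  by rewrite /a /u /grid /= !expr0 mul0r !invr1 add0r mulr1.
apply: (le_trans (cell_halve n)).
have -> : (W 1 - W 0) / 2 ^+ n.+1 = (W 1 - W 0) / 2 ^+ n / 2.
  by rewrite exprS; field; rewrite expf_neq0.
by lra.
Qed.

Lemma cell_nested n m : (n <= m)%N -> a n <= a m /\ a m + u m <= a n + u n.
Proof.
move=> /subnKC <-; elim: (m - n)%N => [|k [IH1 IH2]]; first by rewrite addn0.
rewrite addnS; have := cell_width_gt0 (n + k); rewrite cell_widthS.
by have [j -> [->|->]] := cell_step (n + k) => ?; lra.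
Qed.

Lemma slow_point_cell n : a n <= slow_point W <= a n + u n.
Proof.
have bnd m : a m <= a n + u n.
  have [nm|mn] := leqP n m.
    by have [_] := cell_nested nm; have := cell_width_gt0 m; lra.
  by have [] := cell_nested (ltnW mn); have := cell_width_gt0 n; lra.
apply/andP; split.
  by apply: ub_le_sup; [exists (a n + u n) => _ [m _ <-]; exact: bnd|exists n].
apply: ge_sup; first by exists (a n); exists n.
by move=> _ [m _ <-]; exact: bnd.
Qed.

(** The middle quarters keep a margin to the ends of the cell, so a whole neighbourhood of the
    limit, of size comparable to the cell, lies in the cell. *)
Lemma slow_point_margin n : a n + u n / 4 <= slow_point W <= a n + 3 * (u n / 4).
Proof.
have := slow_point_cell n.+1; rewrite cell_widthS.
have := cell_width_gt0 n.
by have [j -> [->|->]] := cell_step n => ?; lra.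
Qed.

Lemma slow_point_itv : 0 < slow_point W < 1.
Proof.
by have := slow_point_margin 0; have := cell_itv 0; have := cell_width_gt0 0; lra.
Qed.

Lemma lt_slow_point q : q < slow_point W <-> exists n, q < a n.
Proof.
split=> [/sup_gt[|_ [n _ <-] qn]|[n qn]]; first by exists (a 0%N); exists 0%N.
  by exists n.
by have := slow_point_cell n; lra.
Qed.

Lemma slow_point_slow n t : 0 <= t <= 1 -> `|t - slow_point W| <= u n / 4 ->
  `|W t - W (slow_point W)| <= (W 1 - W 0) / 2 ^+ n.
Proof.
move=> t01; rewrite ler_norml => hx.
have hm := slow_point_margin n; have [a0 a1] := cell_itv n; have u0 := cell_width_gt0 n.
apply: le_trans (cell_small n); set x := slow_point W in hx hm *.
have h1 : W (a n) <= W t by apply: ndW; lra.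
have h2 : W t <= W (a n + u n) by apply: ndW; lra.
have h3 : W (a n) <= W x by apply: ndW; lra.
have h4 : W x <= W (a n + u n) by apply: ndW; lra.
by rewrite ler_norml; lra.
Qed.

End Nested.

(** A Hoelder condition of exponent 1/2 at x, in the dyadic form in which it is produced and
    used. *)
Definition slow_at f x (K : R) : Prop := forall n t, 0 <= t <= 1 ->
  `|t - x| <= 2 ^- (n + n) / 4 -> `|f t - f x| <= K / 2 ^+ n.

Lemma rat_variation_mono f : intermediate_BV f -> nondecreasing01 (rat_variation f).
Proof.
move=> fi x y x0 xy y1; have := rat_variation_step fi x0 xy y1.
by apply: le_trans; rewrite lerDl.
Qed.

Lemma rat_variation_dist f x y : intermediate_BV f -> 0 <= x <= 1 -> 0 <= y <= 1 ->
  `|f y - f x| <= `|rat_variation f y - rat_variation f x|.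
Proof.
move=> fi x01 y01; wlog xy : x y x01 y01 / x <= y.
  by move=> h; case: (leP x y) => [|/ltW] xy; [|rewrite distrC [leRHS]distrC]; exact: h.
have x0 : 0 <= x by lra. have y1 : y <= 1 by lra.
have := rat_variation_step fi x0 xy y1 => h.
by apply: le_trans (ler_norm _); lra.
Qed.

Definition var_point f : R := slow_point (rat_variation f).

Lemma var_point_slow f : intermediate_BV f ->
  0 < var_point f < 1 /\ exists2 K, 0 <= K & slow_at f (var_point f) K.
Proof.
move=> fi; have ndW := rat_variation_mono fi.
have x01 := slow_point_itv (rat_variation f); split => //.
exists (rat_variation f 1 - rat_variation f 0); first by rewrite subr_ge0 ndW.
move=> n t t01 tx; apply: le_trans (slow_point_slow ndW t01 tx).
by apply: rat_variation_dist => //; rewrite /var_point; lra.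
Qed.

Lemma Rcomp_var_point (C : ctx) (f : idx C -> R -> R) : @oracle R C f -> (forall i,
  intermediate_BV (f i)) ->
  computableR C (fun i => var_point (f i)).
Proof.
move=> of_ fi; apply: (@eq_dec (ext C) (fun p => exists n,
   rat_real R p.2 < grid (cell (rat_variation (f p.1)) n) n)).
  by move=> [i c]; rewrite lt_slow_point.
have cW (D : ctx) (pi : idx D -> idx C) (A n : idx D -> nat) : @oracle R D (f \o pi) ->
    computable D A -> computable D n ->
    computableR D (fun i => rat_variation (f (pi i)) (clamp (grid (A i) (n i)))).
  move=> oD cA cn; apply: (Rcomp_variation oD).
  - by apply: Rcomp_clamp; rewrite /grid; decide_real.
  - by move=> i; exact: fi.
  - by move=> i; exact: clamp_itv.
have ccell : computable (ext C) (fun p => cell (rat_variation (f p.1)) p.2).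
  apply: (comp_primrec (C := C) (a := fun=> 0%N) (h := fun i n A => (4 * A +
    if `[< flatter (rat_variation (f i)) A n >] then 1 else 2)%N)); first by decide_real.
  have o2 : @oracle R (ext (ext C)) (f \o (fun p => p.1.1)) := oracle_ext (oracle_ext
    of_).
  apply: comp_add; first by decide_real.
  apply: comp_if; [|by decide_real|by decide_real].
  by rewrite /flatter; apply: dec_le; apply: Rcomp_sub; apply: (cW _ _ _ _ o2);
    decide_real.
have ccell2 : computable (ext (ext C)) (fun p => cell (rat_variation (f p.1.1)) p.2).
  exact: comp_reindex (reindex_lift (reindex_skip (reindex_refl C))) ccell.
by rewrite /grid; decide_real.
Qed.

End SlowPoint.

(** * Integration of bounded measurable functions on the unit interval *)

Section UnitIntegral.
Variable R : realType.
Implicit Types (f g : R -> R) (x t : R).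
Local Notation I01 := (`[0, 1]%classic : set R).
Local Notation lebesgue := (@lebesgue_measure R).

Definition int01 f : R := \int[lebesgue]_(t in I01) f t.

Definition bmeas f : Prop := measurable_fun I01 f /\
  exists B : R, forall t, 0 <= t <= 1 -> `|f t| <= B.

Let in01 t : I01 t = (0 <= t <= 1). Proof. by rewrite /= in_itv. Qed.

Lemma mI01 : measurable I01. Proof. exact: measurable_itv. Qed.

Lemma unit_measure : lebesgue I01 = 1%:E.
Proof. by rewrite lebesgue_measure_itv /= lte_fin ltr01 oppr0 adde0. Qed.

Lemma bmeas_int f : bmeas f -> lebesgue.-integrable I01 (EFin \o f).
Proof.
move=> [mf [B hB]]; apply: measurable_bounded_integrable => //.
  by rewrite /= unit_measure ltry.
exists B; split; first exact: num_real.
by move=> M BM t /=; rewrite in_itv /= => /hB /le_trans; apply; exact: ltW.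
Qed.

Lemma bmeas_add f g : bmeas f -> bmeas g -> bmeas (fun t => f t + g t).
Proof.
move=> [mf [B hB]] [mg [D hD]]; split; first exact: measurable_funD.
by exists (B + D) => t t01; rewrite (le_trans (ler_normD _ _)) // lerD ?hB ?hD.
Qed.

Lemma bmeas_mul f g : bmeas f -> bmeas g -> bmeas (fun t => f t * g t).
Proof.
move=> [mf [B hB]] [mg [D hD]]; split; first exact: measurable_funM.
by exists (B * D) => t t01; rewrite normrM ler_pM ?hB ?hD.
Qed.

Lemma bmeas_cst c : bmeas (fun=> c).
Proof. by split; [exact: measurable_cst|exists `|c|]. Qed.

Lemma bmeas_sub f g : bmeas f -> bmeas g -> bmeas (fun t => f t - g t).
Proof.
move=> [mf [B hB]] [mg [D hD]]; split; first exact: measurable_funB.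
by exists (B + D) => t t01; rewrite (le_trans (ler_normB _ _)) // lerD ?hB ?hD.
Qed.

Lemma bmeas_norm f : bmeas f -> bmeas (fun t => `|f t|).
Proof.
move=> [mf [B hB]]; split; first exact: measurableT_comp.
by exists B => t t01; rewrite normr_id hB.
Qed.

Lemma bmeas_sum n (F : nat -> R -> R) : (forall k, bmeas (F k)) ->
  bmeas (fun t => \sum_(k < n) F k t).
Proof.
move=> bF; elim: n => [|n IHn].
  by rewrite (_ : (fun _ => _) = fun=> 0); [exact: bmeas_cst|apply/funext => t;
    rewrite big_ord0].
rewrite (_ : (fun _ => _) = fun t => \sum_(k < n) F k t + F n t).
  exact: bmeas_add.
by apply/funext => t; rewrite big_ord_recr.
Qed.

Lemma bmeas_continuous f B : continuous f -> (forall t, 0 <= t <= 1 -> `|f t| <= B) ->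
  bmeas f.
Proof.
move=> cf hB; split; last by exists B.
by apply: measurable_funTS; exact: continuous_measurable_fun.
Qed.

Lemma bmeas_indic (a b : R) : bmeas (\1_(`[a, b]%classic : set R) : R -> R).
Proof.
split; first by apply: measurable_indic; exact: measurable_itv.
by exists 1 => t _; rewrite indicE; case: (_ \in _); rewrite ?normr1 ?normr0.
Qed.

Lemma bmeas_eq f g : (forall t, 0 <= t <= 1 -> f t = g t) -> bmeas f -> bmeas g.
Proof.
move=> fg [mf [B hB]]; split; last by exists B => t t01; rewrite -fg ?hB.
by apply: eq_measurable_fun mf => t; rewrite inE in01; exact: fg.
Qed.

Lemma int01_eq f g : (forall t, 0 <= t <= 1 -> f t = g t) -> int01 f = int01 g.
Proof. by move=> fg; apply: eq_Rintegral => t; rewrite inE in01; exact: fg. Qed.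

Lemma int01_add f g : bmeas f -> bmeas g ->
  int01 (fun t => f t + g t) = int01 f + int01 g.
Proof. by move=> bf bg; apply: RintegralD; rewrite ?bmeas_int //; exact: mI01. Qed.

Lemma int01_sub f g : bmeas f -> bmeas g ->
  int01 (fun t => f t - g t) = int01 f - int01 g.
Proof. by move=> bf bg; apply: RintegralB; rewrite ?bmeas_int //; exact: mI01. Qed.

Lemma int01_scale c f : bmeas f -> int01 (fun t => c * f t) = c * int01 f.
Proof. by move=> bf; apply: RintegralZl; rewrite ?bmeas_int //; exact: mI01. Qed.

Lemma int01_le f g : bmeas f -> bmeas g -> (forall t, 0 <= t <= 1 -> f t <= g t) ->
  int01 f <= int01 g.
Proof.
by move=> bf bg fg; apply: le_Rintegral; rewrite ?bmeas_int.
Qed.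

Lemma int01_ge0 f : (forall t, 0 <= t <= 1 -> 0 <= f t) -> 0 <= int01 f.
Proof. by move=> f0; apply: Rintegral_ge0 => t; rewrite in01; exact: f0. Qed.

Lemma int01_norm f : bmeas f -> `|int01 f| <= int01 (fun t => `|f t|).
Proof. by move=> bf; apply: (@le_normr_Rintegral _ _ R lebesgue_measure) => //;
  exact: bmeas_int. Qed.

Lemma int01_cst c : int01 (fun=> c) = c.
Proof. by rewrite /int01 Rintegral_cst //= unit_measure mulr1. Qed.

Lemma int01_sum n (F : nat -> R -> R) : (forall k, bmeas (F k)) ->
  int01 (fun t => \sum_(k < n) F k t) = \sum_(k < n) int01 (F k).
Proof.
move=> bF; elim: n => [|n IHn].
  rewrite big_ord0 -[RHS](int01_cst 0); apply: int01_eq => t _; exact: big_ord0.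
rewrite [RHS]big_ord_recr /= -IHn -(int01_add (bmeas_sum _ bF) (bF n)).
by apply: int01_eq => t _; rewrite big_ord_recr.
Qed.

Lemma int01_indic (a b : R) : a <= b -> int01 (\1_(`[a, b]%classic : set R)) <= b - a.
Proof.
move=> ab; rewrite /int01 /Rintegral integral_indic //=.
have mab : lebesgue `[a, b]%classic = (b - a)%:E.
  rewrite lebesgue_measure_itv /= lte_fin; case: ltP => // ba.
  by rewrite (_ : b = a) ?subrr //; apply/le_anti; rewrite ab ba.
rewrite -lee_fin -mab fineK; first by apply: le_measure; rewrite ?inE //;
  apply: measurableI.
rewrite ge0_fin_numE //; apply: (@le_lt_trans _ _ (lebesgue I01));
  last by rewrite unit_measure ltry.
by apply: le_measure; rewrite ?inE //; apply: measurableI.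
Qed.

Lemma BV_bmeas f : bounded_variation 0 1 f -> bmeas f.
Proof.
move=> /BV_monotone_diff[g [h [ndg ndh fE]]].
have mono (k : R -> R) : {in `[0, 1] &, nondecreasing_fun k} -> bmeas k.
  move=> ndk; apply: (@bmeas_eq (k \o @clamp R)).
    by move=> t t01 /=; rewrite clamp_id.
  have c01 t : @clamp R t \in `[0, 1] by rewrite in_itv /= clamp_itv.
  split; last first.
    exists (`|k 0| + `|k 1|) => t t01 /=.
    have h0 : k 0 <= k (clamp t) by apply: ndk;
      rewrite ?c01 ?in_itv /= ?lexx ?ler01 //; case/andP: (clamp_itv t).
    have h1 : k (clamp t) <= k 1 by apply: ndk;
      rewrite ?c01 ?in_itv /= ?lexx ?ler01 //; case/andP: (clamp_itv t).
    by have := normr_ge0 (k 0); have := normr_ge0 (k 1); have := ler_norm (k 1);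
       have := ler_norm (- k 0); rewrite normrN ler_norml; lra.
  apply: nondecreasing_measurable; first exact: mI01.
  move=> s t st; apply: ndk => //; rewrite /clamp ge_max le_max lexx /= le_max.
  by apply/orP; right; rewrite le_min !ge_min st lexx orbT.
apply: (@bmeas_eq (fun t => g t - h t)); last by apply: bmeas_sub; exact: mono.
by move=> t t01; rewrite fE // in_itv.
Qed.

End UnitIntegral.

(** * The Dirichlet kernel *)

Section Trig.
Variable R : realType.
Implicit Types (f g h : R -> R) (x t u : R).

Lemma sin_shift a (k : nat) : sin (a + 2 * pi * k%:R) = sin a :> R.
Proof. by rewrite -(periodicn (@sinD2pi R) k a); congr (sin (_ + _));
  rewrite -[RHS]mulr_natr -(mulr_natr pi); ring. Qed.

Lemma sin_aff_continuous (c x : R) : continuous (fun t => sin (c * (t - x))).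
Proof.
move=> t; apply: continuous_comp; last exact: continuous_sin.
by apply: cvgM; [exact: cvg_cst|apply: cvgB; [exact: cvg_id|exact: cvg_cst]].
Qed.

Lemma cos_aff_continuous (c x : R) : continuous (fun t => cos (c * (t - x))).
Proof.
move=> t; apply: continuous_comp; last exact: continuous_cos.
by apply: cvgM; [exact: cvg_cst|apply: cvgB; [exact: cvg_id|exact: cvg_cst]].
Qed.

Lemma bmeas_cos (c x : R) : bmeas (fun t => cos (c * (t - x))).
Proof. by apply: (@bmeas_continuous R _ 1); [exact: cos_aff_continuous|move=> t _;
  exact: cos_max]. Qed.

Lemma bmeas_sin (c x : R) : bmeas (fun t => sin (c * (t - x))).
Proof. by apply: (@bmeas_continuous R _ 1); [exact: sin_aff_continuous|move=> t _;
  exact: sin_max]. Qed.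

Lemma int01_cos (k : nat) x : (0 < k)%N ->
  int01 (fun t => cos (2 * pi * k%:R * (t - x))) = 0.
Proof.
move=> k0; set c := 2 * pi * k%:R.
have c0 : c != 0 by rewrite !mulf_neq0 ?pnatr_eq0 -?lt0n ?gt_eqF ?pi_gt0.
pose F t := c^-1 * sin (c * (t - x)).
have cF : continuous F.
  by move=> t; apply: cvgM; [exact: cvg_cst|exact: sin_aff_continuous].
have dF t : is_derive t 1 F (cos (c * (t - x))).
  rewrite /F; apply: is_derive_eq.
  rewrite /GRing.scale /=; field => //.
rewrite /int01 /Rintegral (@continuous_FTC2 _ _ F) ?ltr01 //.
- rewrite /= /F (_ : c * (1 - x) = c * (0 - x) + 2 * pi * k%:R); last by rewrite -/c;
  ring.
  by rewrite sin_shift subrr.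
- by apply: continuous_subspaceT; exact: cos_aff_continuous.
- split.
  + by move=> t _; have [] := dF t.
  + by apply: cvg_at_right_filter; exact: cF.
  + by apply: cvg_at_left_filter; exact: cF.
- by move=> t _; rewrite derive1E; apply: derive_val.
Qed.

Definition dirichlet (N : nat) u : R := 1 + \sum_(k < N) 2 * cos (2 * pi * k.+1%:R * u).

(** The sum telescopes after multiplication by sin (pi u). *)
Lemma dirichlet_sin N u : sin (pi * u) * dirichlet N u = sin ((N.*2.+1)%:R * pi * u).
Proof.
rewrite /dirichlet; elim: N => [|N IHN].
  by rewrite big_ord0 addr0 mulr1 mul1r.
rewrite big_ord_recr /= addrA mulrDr IHN.
have -> : (N.*2.+1)%:R * pi * u = 2 * pi * N.+1%:R * u - pi * u.
  by rewrite -!natr1 -muln2 natrM; ring.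
have -> : (N.+1.*2.+1)%:R * pi * u = 2 * pi * N.+1%:R * u + pi * u.
  by rewrite doubleS -!natr1 -muln2 natrM; ring.
by rewrite sinB sinD; ring.
Qed.

Lemma dirichlet_norm N u : `|dirichlet N u| <= N.*2.+1%:R.
Proof.
rewrite /dirichlet -(@natr1 R N.*2) [leRHS]addrC; apply: (le_trans (ler_normD _ _)).
rewrite normr1 lerD2l; apply: (le_trans (ler_norm_sum _ _ _)).
have -> : N.*2%:R = \sum_(k < N) 2 :> R.
  by rewrite sumr_const card_ord -[RHS]mulr_natl -muln2 natrM.
apply: ler_sum => k _.
by rewrite normrM ger0_norm // ler_piMr // cos_max.
Qed.

Let term x (k : nat) t : R := 2 * cos (2 * pi * k.+1%:R * (t - x)).

Let bmeas_term x k : bmeas (term x k).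
Proof. by apply: bmeas_mul; [exact: bmeas_cst|exact: bmeas_cos]. Qed.

Lemma bmeas_dirichlet N x : bmeas (fun t => dirichlet N (t - x)).
Proof. exact: bmeas_add (bmeas_cst 1) (bmeas_sum N (bmeas_term x)). Qed.

Lemma int01_dirichlet N x : int01 (fun t => dirichlet N (t - x)) = 1.
Proof.
rewrite (int01_add (bmeas_cst 1) (bmeas_sum N (bmeas_term x))) int01_cst (int01_sum _
  (bmeas_term x)).
rewrite big1 ?addr0 // => k _.
by rewrite (int01_scale 2 (bmeas_cos _ x)) int01_cos ?mulr0.
Qed.

Lemma fourier_sumE f N x : bmeas f ->
  fourier_sum f N x = int01 (fun t => f t * dirichlet N (t - x)).
Proof.
move=> bf; have bc c y : bmeas (fun t => f t * cos (c * (t - y))) by apply: bmeas_mul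
  => //; exact: bmeas_cos.
have bs c y : bmeas (fun t => f t * sin (c * (t - y))) by apply: bmeas_mul => //;
  exact: bmeas_sin.
have bc0 c : bmeas (fun t => f t * cos (c * t)).
  by apply: bmeas_eq (bc c 0) => t _; rewrite subr0.
have bs0 c : bmeas (fun t => f t * sin (c * t)).
  by apply: bmeas_eq (bs c 0) => t _; rewrite subr0.
have -> : int01 (fun t => f t * dirichlet N (t - x)) =
    int01 f + \sum_(k < N) 2 * int01 (fun t => f t * cos (2 * pi * k.+1%:R * (t - x))).
  have bt k : bmeas (fun t => 2 * (f t * cos (2 * pi * k.+1%:R * (t - x)))).
    exact: bmeas_mul (bmeas_cst 2) (bc _ x).
  under eq_bigr => k _ do rewrite -(int01_scale 2 (bc _ x)).
  rewrite -(int01_sum _ bt) -(int01_add bf (bmeas_sum _ bt)).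
  apply: int01_eq => t _; rewrite /dirichlet mulrDr mulr1 mulr_sumr; congr (_ + _).
  by apply: eq_bigr => k _; ring.
rewrite /fourier_sum; congr (_ + _).
  rewrite /fourier_cos mulrC mulKf //; apply: int01_eq => t _.
  by rewrite mulr0 mul0r cos0 mulr1.
rewrite big_add1 /= big_mkord; apply: eq_bigr => k _.
rewrite /fourier_cos /fourier_sin; set c := 2 * pi * k.+1%:R.
rewrite -/(int01 _) -/(int01 _) (@int01_eq R (fun t => f t * cos (c * (t - x)))
  (fun t => cos (c * x) * (f t * cos (c * t)) + sin (c * x) * (f t * sin (c * t))));
    last first.
  by move=> t _; rewrite mulrBr cosB; ring.
rewrite int01_add ?int01_scale //; try by apply: bmeas_mul => //; exact: bmeas_cst.
by ring.
Qed.
End Trig.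

(** * Bessel's inequality for odd frequencies *)

Section Convergence.
Variable R : realType.
Implicit Types (f g h : R -> R) (x t u : R).

(** On [0, 1/4] the mean value theorem compares sin (pi u) with u; on [1/4, s] the sine has a
    positive minimum, because s < 1. *)
Lemma sin_lower (s : R) : s < 1 -> exists2 c : R, 0 < c &
  forall u, `|u| <= s -> c * `|u| <= `|sin (pi * u)|.
Proof.
move=> s1; have p0 := pi_gt0 R.
have [m m0 hm] : exists2 m : R, 0 < m & forall u, 1 / 4 <= u <= s -> m <= sin (pi * u).
  have [s4|s4] := ltP s (1 / 4).
    by exists 1 => // u; lra.
  have cs : {within `[1 / 4, s], continuous (fun u => sin (pi * (u - 0)) : R)}.
    by apply: continuous_subspaceT; exact: sin_aff_continuous.
  have [c cI hc] := EVT_min s4 cs; exists (sin (pi * c)).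
    apply: sin_gt0_pi; move: cI; rewrite in_itv /= => /andP[c1 c2].
    by rewrite mulr_gt0 ?gtr_pMr //; lra.
  by move=> u hu; have := hc u; rewrite !subr0; apply; rewrite in_itv.
have c40 : 0 < cos (pi / 4) :> R by apply: cos_gt0_pihalf; lra.
exists (Num.min (pi * cos (pi / 4)) m) => [|u us]; first by rewrite lt_min m0 mulr_gt0.
have -> : `|sin (pi * u)| = `|sin (pi * `|u|)|.
  case: (leP 0 u) => hu; first by rewrite (ger0_norm hu).
  by rewrite (ltr0_norm hu) mulrN sinN normrN.
move: {u}`|u| us (normr_ge0 u) => u us u0.
have [u4|u4] := leP (1 / 4) u.
  apply: le_trans (ler_norm _); apply: le_trans (hm u _); last by rewrite u4.
  apply: (@le_trans _ _ (m * u)); first by rewrite ler_wpM2r // ge_min lexx orbT.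
  by rewrite ger_pMr //; lra.
have [->|un] := eqVneq u 0; first by rewrite !mulr0 sin0 normr0.
have up : 0 < pi * u by rewrite mulr_gt0 // lt_neqAle eq_sym un.
have [|xi + e] := @MVT R sin cos 0 (pi * u) up (fun y _ => is_derive_sin y).
  by apply: continuous_subspaceT => y; exact: continuous_sin.
rewrite in_itv /= => /andP[x0 x1].
apply: le_trans (ler_norm _); move: e; rewrite sin0 !subr0 => ->.
apply: (@le_trans _ _ (pi * cos (pi / 4) * u)); first by rewrite ler_wpM2r // ge_min lexx.
rewrite [pi * _]mulrC -mulrA ler_wpM2r ?(ltW up) // ltW // ltr_cos ?in_itv /=.
- by apply: lt_trans x1 _; rewrite mulrC; nra.
- by rewrite (ltW x0) /=; nra.
- by lra.
Qed.

Definition osc x (N : nat) t : R := sin (N.*2.+1%:R * pi * (t - x)).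

Lemma bmeas_osc x N : bmeas (osc x N). Proof. exact: bmeas_sin. Qed.

Lemma int01_osc_orth x N M : (M < N)%N -> int01 (fun t => osc x N t * osc x M t) = 0.
Proof.
move=> MN; pose c (k : nat) t : R := cos (2 * pi * k%:R * (t - x)).
rewrite (@int01_eq R _ (fun t => 2^-1 * (c (N - M)%N t - c (N + M.+1)%N t))).
  rewrite (int01_scale _ (bmeas_sub (bmeas_cos _ x) (bmeas_cos _ x))) (int01_sub
    (bmeas_cos _ x) (bmeas_cos _ x)).
  by rewrite !int01_cos ?subr0 ?mulr0 ?subn_gt0 // addnS.
move=> t _; rewrite /osc /c.
have -> : 2 * pi * (N - M)%:R * (t - x) = N.*2.+1%:R * pi * (t - x) - M.*2.+1%:R * pi *
  (t - x).
  by rewrite natrB ?(ltnW MN) // -!natr1 -!muln2 !natrM; ring.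
have -> : 2 * pi * (N + M.+1)%:R * (t - x) = N.*2.+1%:R * pi * (t - x) + M.*2.+1%:R *
  pi * (t - x).
  by rewrite natrD -!natr1 -!muln2 !natrM; ring.
by rewrite cosB cosD; field.
Qed.

Lemma int01_osc_sq x N : int01 (fun t => osc x N t ^+ 2) = 2^-1.
Proof.
pose c (k : nat) t : R := cos (2 * pi * k%:R * (t - x)).
rewrite (@int01_eq R _ (fun t => 2^-1 * (1 - c (N.*2.+1)%N t))).
  rewrite (int01_scale _ (bmeas_sub (bmeas_cst 1) (bmeas_cos _ x))) (int01_sub
    (bmeas_cst 1) (bmeas_cos _ x)).
  by rewrite int01_cst int01_cos // subr0 mulr1.
move=> t _; rewrite /osc /c.
have -> : 2 * pi * N.*2.+1%:R * (t - x) = (N.*2.+1%:R * pi * (t - x)) *+ 2.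
  by rewrite -mulr_natr; ring.
by rewrite cos_mulr2n sin2cos2 -mulr_natr; field.
Qed.

Section Bessel.
Variables (h : R -> R) (x : R).
Hypothesis bh : bmeas h.
Let c N := int01 (fun t => h t * osc x N t).

Let residual (n : nat) t := h t - \sum_(k < n) 2 * c k * osc x k t.

Let bmeas_part k : bmeas (fun t => 2 * c k * osc x k t).
Proof. exact: bmeas_mul (bmeas_cst _) (bmeas_osc x k). Qed.

Let bmeas_residual n : bmeas (residual n).
Proof. exact: bmeas_sub bh (bmeas_sum n bmeas_part). Qed.

Let residual_coef n m : (n <= m)%N -> int01 (fun t => residual n t * osc x m t) = c m.
Proof.
elim: n => [|n IHn] nm.
  by apply: int01_eq => t _; rewrite /residual big_ord0 subr0.
rewrite -[RHS]subr0 -[in RHS](IHn (ltnW nm)).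
have b1 : bmeas (fun t => residual n t * osc x m t) := bmeas_mul (bmeas_residual n)
  (bmeas_osc x m).
have b2 : bmeas (fun t => osc x m t * osc x n t) := bmeas_mul (bmeas_osc x m)
  (bmeas_osc x n).
rewrite -[X in _ - X](mulr0 (2 * c n)) -(int01_osc_orth x nm) -(int01_scale _ b2).
rewrite -(int01_sub b1 (bmeas_mul (bmeas_cst _) b2)); apply: int01_eq => t _.
by rewrite /residual big_ord_recr /=; ring.
Qed.

(** Subtracting the projections on the oscillations one at a time: orthogonality makes the
    square integral drop by 2 c_k^2 at each step. *)
Let residual_sq n : int01 (fun t => residual n t ^+ 2) =
  int01 (fun t => h t ^+ 2) - 2 * \sum_(k < n) c k ^+ 2.
Proof.
elim: n => [|n IHn].
  by rewrite big_ord0 mulr0 subr0; apply: int01_eq => t _;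
    rewrite /residual big_ord0 subr0.
have b0 : bmeas (fun t => residual n t ^+ 2).
  by apply: bmeas_eq (bmeas_mul (bmeas_residual n) (bmeas_residual n)) => t _;
    rewrite expr2.
have b1 : bmeas (fun t => residual n t * osc x n t) := bmeas_mul (bmeas_residual n)
  (bmeas_osc x n).
have b2 : bmeas (fun t => osc x n t ^+ 2).
  by apply: bmeas_eq (bmeas_mul (bmeas_osc x n) (bmeas_osc x n)) => t _; rewrite expr2.
rewrite (@int01_eq R _ (fun t => (residual n t ^+ 2 - 4 * c n * (residual n t * osc x n
  t)) +
   4 * c n ^+ 2 * osc x n t ^+ 2)); last first.
  by move=> t _; rewrite /residual big_ord_recr /=; ring.
rewrite (int01_add (bmeas_sub b0 (bmeas_mul (bmeas_cst _) b1)) (bmeas_mul (bmeas_cst _)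
  b2)).
rewrite (int01_sub b0 (bmeas_mul (bmeas_cst _) b1)) !int01_scale // int01_osc_sq
  residual_coef // IHn.
by rewrite big_ord_recr /=; field.
Qed.

(** The squares of the coefficients are summable, so the coefficients tend to 0. *)
Lemma bessel_cvg : int01 (fun t => h t * osc x N t) @[N --> \oo] --> (0 : R).
Proof.
have bnd n : \sum_(k < n) c k ^+ 2 <= int01 (fun t => h t ^+ 2).
  have : 0 <= int01 (fun t => residual n t ^+ 2) by apply: int01_ge0 => t _;
    exact: sqr_ge0.
  have : 0 <= int01 (fun t => h t ^+ 2) by apply: int01_ge0 => t _; exact: sqr_ge0.
  by rewrite residual_sq; lra.
have cs : cvgn (series (fun k => c k ^+ 2)).
  apply: nondecreasing_is_cvgn.
    apply/nondecreasing_seqP => n; rewrite /series /= big_nat_recr //= lerDl.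
    exact: sqr_ge0.
  by exists (int01 (fun t => h t ^+ 2)) => _ [n _ <-]; rewrite /series /= big_mkord.
move/cvgrPdist_lt : (cvg_series_cvg_0 cs) => c0.
apply/cvgrPdist_lt => e e0; have [N _ hN] := c0 (e ^+ 2) (exprn_gt0 2 e0).
exists N => // n /= Nn; have := hN n Nn; rewrite !sub0r !normrN normrX.
by rewrite ltr_pXn2r // nnegrE ltW.
Qed.
End Bessel.
End Convergence.

(** * Convergence of the Fourier series at a slow point *)

Section FourierAtSlowPoint.
Variable R : realType.
Variables (f : R -> R) (x K : R).
Hypotheses (bf : bmeas f) (x01 : 0 < x < 1) (K0 : 0 <= K) (slow : slow_at f x K).
Implicit Types (t : R) (n N : nat).

Let r n : R := 2 ^- (n + n) / 4.
Let phi N t := (f t - f x) * dirichlet N (t - x).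
Let near n : R -> R := \1_(`[x - r n, x + r n]%classic : set R).

Let r_gt0 n : 0 < r n. Proof. by rewrite /r divr_gt0 // invr_gt0 exprn_gt0. Qed.

Let rS n : r n.+1 = r n / 4.
Proof. by rewrite /r addSn addnS !exprS; field; rewrite expf_neq0. Qed.

Let nearE n t : near n t = (nat_of_bool (`|t - x| <= r n)%R)%:R.
Proof.
rewrite /near indicE; congr (_%:R); congr nat_of_bool.
by apply/idP/idP; rewrite inE /= in_itv /= ler_norml; lra.
Qed.

Let bmeas_phi N : bmeas (phi N).
Proof. exact: bmeas_mul (bmeas_sub bf (bmeas_cst _)) (bmeas_dirichlet N x). Qed.

Let bmeas_near n : bmeas (near n). Proof. exact: bmeas_indic. Qed.

Let A n N := int01 (fun t => `|phi N t| * near n t).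

Let bmeas_A n N : bmeas (fun t => `|phi N t| * near n t).
Proof. exact: bmeas_mul (bmeas_norm (bmeas_phi N)) (bmeas_near n). Qed.

Let int01_near n : int01 (near n) <= 2 * r n.
Proof.
by apply: le_trans (int01_indic _) _; have := r_gt0 n; lra.
Qed.

Lemma dist_lt1 : exists2 s : R, s < 1 & forall t, 0 <= t <= 1 -> `|t - x| <= s.
Proof.
exists (Num.max x (1 - x)); first by rewrite gt_max; move: x01; lra.
move=> t t01; rewrite le_max; apply/orP.
by case: (leP x t) => ?; [right|left]; rewrite ler_norml; lra.
Qed.

Let fourier_sub N : fourier_sum f N x - f x = int01 (phi N).
Proof.
rewrite fourier_sumE // -[X in _ - X]mulr1 -(int01_dirichlet N x).
rewrite -(int01_scale _ (bmeas_dirichlet N x)).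
rewrite -(int01_sub (bmeas_mul bf (bmeas_dirichlet N x)) (bmeas_mul (bmeas_cst _)
  (bmeas_dirichlet N x))).
by apply: int01_eq => t _; rewrite /phi mulrBl.
Qed.

(** Passing from radius r (m+1) to radius r m = 4 r (m+1) adds a ring of total length at most
    2 r m, on which the oscillation is at most K 2^-m and the kernel at most 1 / (c r (m+1)).
    The additions form a geometric series that does not depend on N. *)
Lemma ring_bound c : 0 < c ->
  (forall t, 0 <= t <= 1 -> c * `|t - x| <= `|sin (pi * (t - x))|) ->
  forall n N, A n N <= 16 * K / c / 2 ^+ n.
Proof.
move=> c0 hc n N.
have step m : A m N <= A m.+1 N + 8 * K / c / 2 ^+ m.
  pose B := K / 2 ^+ m / (c * r m.+1).
  have rm := r_gt0 m; have rm1 := r_gt0 m.+1.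
  have p0 : 0 < 2 ^+ m :> R by rewrite exprn_gt0.
  have B0 : 0 <= B by rewrite /B !divr_ge0 ?mulr_ge0 // ltW.
  apply: (@le_trans _ _ (A m.+1 N + B * int01 (near m))).
    rewrite -(int01_scale _ (bmeas_near m)) -(int01_add (bmeas_A m.+1 N) (bmeas_mul
      (bmeas_cst B) (bmeas_near m))).
    apply: (int01_le (bmeas_A m N) (bmeas_add (bmeas_A m.+1 N) (bmeas_mul (bmeas_cst B)
      (bmeas_near m)))).
    move=> t t01; rewrite !nearE; case: (leP _ (r m)) => tm; last first.
      by rewrite !mulr0 addr0 mulr_ge0.
    case: (leP _ (r m.+1)) => tm1; first by rewrite !mulr1 lerDl.
    rewrite !mulr1 mulr0 add0r /phi normrM.
    have h1 : `|f t - f x| <= K / 2 ^+ m by exact: slow.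
    have h2 : `|dirichlet N (t - x)| * (c * r m.+1) <= 1.
      apply: (@le_trans _ _ (`|dirichlet N (t - x)| * `|sin (pi * (t - x))|)).
        apply: ler_wpM2l => //; apply: le_trans (hc t t01).
        by rewrite ler_wpM2l ?(ltW c0) // ltW.
      by rewrite -normrM mulrC dirichlet_sin sin_max.
    by apply: ler_pM => //; rewrite -div1r ler_pdivlMr // mulr_gt0.
  rewrite lerD2l; apply: (@le_trans _ _ (B * (2 * r m))); first by rewrite ler_wpM2l ?int01_near.
  rewrite /B rS le_eqVlt; apply/orP; left; apply/eqP; field.
  by rewrite expf_neq0 ?gt_eqF.
have chain m : A n N <= A (n + m) N + 16 * K / c * (2 ^- n - 2 ^- (n + m)).
  elim: m => [|m IHm]; first by rewrite addn0 subrr mulr0 addr0.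
  apply: (le_trans IHm); rewrite addnS; have := step (n + m)%N.
  have -> : 2 ^- (n + m).+1 = 2 ^- (n + m) / 2 :> R by rewrite exprS; field;
    rewrite expf_neq0.
  rewrite (_ : 8 * K / c / 2 ^+ (n + m) = 16 * K / c * (2 ^- (n + m) / 2));
    last by field; rewrite expf_neq0 ?gt_eqF.
  by move=> h; rewrite mulrBr [X in _ <= _ + X]mulrBr; lra.
have tail m : A m N <= K * N.*2.+1%:R / 2 ^+ m.
  rewrite -(int01_cst (K * N.*2.+1%:R / 2 ^+ m)); apply: int01_le => //;
    first exact: bmeas_cst.
  move=> t t01; rewrite nearE; case: (leP _ (r m)) => tm.
    rewrite mulr1 /phi normrM mulrAC; apply: ler_pM => //; first exact: slow.
    exact: dirichlet_norm.
  by rewrite mulr0 !mulr_ge0 // invr_ge0 exprn_ge0.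
apply/ler_addgt0Pr => e e0.
have e1 : 0 < e / (K * N.*2.+1%:R + 1) by rewrite divr_gt0 // ltr_wpDl // mulr_ge0.
have [m hm] := pow2_small e1; apply: (le_trans (chain m)).
have Kc : 0 <= 16 * K / c by rewrite !mulr_ge0 // invr_ge0 ltW.
have t1 : A (n + m) N <= e.
  apply: (le_trans (tail _)).
  have := hm (n + m)%N (leq_addl _ _); rewrite ltr_pdivlMr;
    last by rewrite ltr_wpDl // mulr_ge0.
  have p0 : 0 < 2 ^- (n + m) :> R by rewrite invr_gt0 exprn_gt0.
  by lra.
have : 0 <= 16 * K / c * 2 ^- (n + m) by rewrite mulr_ge0 // invr_ge0 exprn_ge0.
by rewrite mulrBr; lra.
Qed.

(** Away from x the Dirichlet kernel is an oscillation divided by a sine bounded away from 0,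
    so the integral is a coefficient of a fixed bounded function. *)
Lemma far_cvg c n : 0 < c ->
  (forall t, 0 <= t <= 1 -> c * `|t - x| <= `|sin (pi * (t - x))|) ->
  int01 (fun t => phi N t * (1 - near n t)) @[N --> \oo] --> (0 : R).
Proof.
move=> c0 hc; pose m := (c * r n) ^+ 2.
have m0 : 0 < m by rewrite exprn_gt0 // mulr_gt0.
(* The maximum differs from the squared sine only near x, where the factor 1 - near
   vanishes; it makes the quotient continuous everywhere, hence measurable. *)
pose d t : R := Num.max (sin (pi * (t - x)) ^+ 2) m.
have dm t : m <= d t by rewrite /d le_max lexx orbT.
have cd : continuous (fun t => (d t)^-1).
  move=> t; apply: cvgV; first by rewrite gt_eqF // (lt_le_trans m0).
  have cs := @sin_aff_continuous R pi x t.
  exact: (@continuous_max _ _ (fun t => sin (pi * (t - x)) ^+ 2) (cst m) t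
    (cvgM cs cs) (cvg_cst _)).
have bd : bmeas (fun t => (d t)^-1).
  apply: (bmeas_continuous (B := m^-1)) => // t _.
  rewrite ger0_norm ?invr_ge0 ?(le_trans (ltW m0)) //.
  by rewrite lef_pV2 // posrE // (lt_le_trans m0).
pose g t := (f t - f x) * (1 - near n t) * (sin (pi * (t - x)) * (d t)^-1).
have bg : bmeas g.
  apply: bmeas_mul; last exact: bmeas_mul (bmeas_sin _ _) bd.
  exact: bmeas_mul (bmeas_sub bf (bmeas_cst _)) (bmeas_sub (bmeas_cst _) (bmeas_near n)).
rewrite (_ : (fun N => _) = fun N => int01 (fun t => g t * osc x N t)).
  exact: bessel_cvg.
apply/funext => N; apply: int01_eq => t t01; rewrite /g /phi nearE.
case: (leP _ (r n)) => tn; first by rewrite !(subrr, mulr0, mul0r).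
have h : m <= sin (pi * (t - x)) ^+ 2.
  rewrite /m -[leRHS](real_normK (num_real _)) ler_pXn2r ?nnegrE ?mulr_ge0 ?(ltW c0)
    ?(ltW (r_gt0 n)) //.
  by apply: le_trans (hc t t01); rewrite ler_wpM2l ?(ltW c0) // ltW.
rewrite /d max_l // /osc -dirichlet_sin; field.
by rewrite -sqrf_eq0 gt_eqF // (lt_le_trans m0).
Qed.

Lemma fourier_cvg : fourier_sum f N x @[N --> \oo] --> f x.
Proof.
have [s s1 hs] := dist_lt1; have [c c0 hc] := sin_lower s1.
have {}hc t : 0 <= t <= 1 -> c * `|t - x| <= `|sin (pi * (t - x))|.
  by move=> /hs; exact: hc.
apply/cvgrPdist_lt => e e0.
have e1 : 0 < e / 2 / (16 * K / c + 1).
  by rewrite !divr_gt0 // ltr_wpDl // !mulr_ge0 // invr_ge0 ltW.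
have [n /(_ n (leqnn n)) hn] := pow2_small e1.
have near_small N : A n N < e / 2.
  apply: (le_lt_trans (ring_bound c0 hc n N)).
  move: hn; rewrite ltr_pdivlMr; last by rewrite ltr_wpDl // !mulr_ge0 // invr_ge0 ltW.
  have p0 : 0 < 2 ^- n :> R by rewrite invr_gt0 exprn_gt0.
  by lra.
have e2 : 0 < e / 2 by lra.
have [N0 _ hN] := (cvgrPdist_lt _ _).1 (far_cvg n c0 hc) _ e2.
exists N0 => // N NN; rewrite distrC fourier_sub.
have -> : int01 (phi N) = int01 (fun t => phi N t * near n t) + int01 (fun t => phi N t
  * (1 - near n t)).
  rewrite -(int01_add (bmeas_mul (bmeas_phi N) (bmeas_near n)) (bmeas_mul (bmeas_phi N)
    (bmeas_sub (bmeas_cst 1) (bmeas_near n)))).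
  by apply: int01_eq => t _; ring.
apply: (le_lt_trans (ler_normD _ _)); rewrite (splitr e); apply: ltrD.
  apply: le_lt_trans (near_small N);
    apply: (le_trans (int01_norm (bmeas_mul (bmeas_phi N) (bmeas_near n)))).
  apply: int01_le; [exact: bmeas_norm (bmeas_mul (bmeas_phi N) (bmeas_near n))|exact:
    bmeas_A|].
  by move=> t _; rewrite normrM nearE [`|_%:R|]ger0_norm.
by have := hN N NN; rewrite /= sub0r normrN.
Qed.

End FourierAtSlowPoint.

(** * Continuity, zeros and derivatives at a slow point *)

Section DifferentiationAtSlowPoint.
Variable R : realType.
Implicit Types (f : R -> R) (x t : R).
Local Notation I01 := (`[0, 1]%classic : set R).

Lemma int01_indic_in (a b : R) : 0 <= a -> a <= b -> b <= 1 ->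
  int01 (\1_(`[a, b]%classic : set R)) = b - a.
Proof.
move=> a0 ab b1; rewrite /int01 /Rintegral integral_indic //=.
rewrite (_ : `[a, b] `&` `[0, 1] = `[a, b]%classic).
  rewrite lebesgue_measure_itv /= lte_fin; case: ltP => // ba.
  by rewrite (_ : b = a) ?subrr //; apply/le_anti; rewrite ab ba.
apply/seteqP; split => [t []//|t] /=; rewrite !in_itv /= => /andP[? ?].
by split; apply/andP; split; lra.
Qed.

(** Both ends of the range of integration are moved into the integrand, so that primitives at
    different points are integrals over the same set. *)
Lemma primitive01E f y : bmeas f -> 0 <= y <= 1 ->
  primitive01 f y = int01 (fun t => f t * \1_(`[0, y]%classic : set R) t).
Proof.
move=> bf /andP[y0 y1].
have -> : primitive01 f y = \int[lebesgue_measure]_(t in I01 `&` `[0, y]) f t.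
  rewrite /primitive01; congr (Rintegral _ _ _).
  apply/seteqP; split => [t|t []//] /=; rewrite !in_itv /= => /andP[t0 ty].
  by rewrite t0 ty (le_trans ty).
rewrite Rintegral_mkcondr; apply: eq_Rintegral => t _.
by rewrite patchE indicE; case: (_ \in _); rewrite ?mulr1 ?mulr0.
Qed.

Lemma slow_dist f x K (e : R) : 0 <= K -> slow_at f x K -> 0 < e ->
  exists2 d, 0 < d & forall t, 0 <= t <= 1 -> `|t - x| <= d -> `|f t - f x| < e.
Proof.
move=> K0 slow e0.
have e1 : 0 < e / (K + 1) by rewrite divr_gt0 // ltr_wpDl.
have [n /(_ n (leqnn n))] := pow2_small e1.
rewrite ltr_pdivlMr ?ltr_wpDl // => hn.
exists (2 ^- (n + n) / 4) => [|t t01 tx]; first by rewrite divr_gt0 // invr_gt0 exprn_gt0.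
apply: (le_lt_trans (slow n t t01 tx)).
have p0 : 0 < 2 ^- n :> R by rewrite invr_gt0 exprn_gt0.
by lra.
Qed.

Lemma slow_continuous f x K : 0 <= K -> slow_at f x K -> continuous01_at f x.
Proof.
move=> K0 slow; apply/cvgrPdist_lt => e e0.
have [d d0 hd] := slow_dist K0 slow e0.
exists d => //= t /= tx; rewrite in_itv /= => t01; rewrite distrC.
by apply: hd => //; rewrite distrC ltW.
Qed.

Lemma slow_zero f x K : 0 <= K -> slow_at f x K -> bmeas f -> 0 < x < 1 ->
  (forall t, 0 <= t <= 1 -> 0 <= f t) -> int01 f = 0 -> f x = 0.
Proof.
move=> K0 slow bf x01 f0 Ef; apply/eqP; rewrite eq_le f0 ?andbT; last by lra.
rewrite leNgt; apply/negP => fx.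
have fx2 : 0 < f x / 2 by lra.
have [d d0 hd] := slow_dist K0 slow fx2.
pose b := Num.min 1 (x + d).
have [b1 bd] : b <= 1 /\ b <= x + d by rewrite /b !ge_min !lexx orbT.
have xb : x < b by rewrite /b lt_min; lra.
have bi := bmeas_indic x b.
have : f x / 2 * (b - x) <= int01 f.
  have <- : int01 (\1_(`[x, b]%classic : set R)) = b - x by apply: int01_indic_in; lra.
  rewrite -(int01_scale _ bi); apply: (int01_le (bmeas_mul (bmeas_cst _) bi) bf) => t t01.
  rewrite indicE; case: (boolP (t \in _)) => [|_]; last by rewrite mulr0 f0.
  rewrite inE /= in_itv /= => /andP[xt tb]; rewrite mulr1.
  have /(hd t t01) : `|t - x| <= d by rewrite ler_norml; lra.
  by rewrite ltr_norml; lra.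
by rewrite Ef leNgt mulr_gt0 // subr_gt0.
Qed.

(** The difference quotient minus f x is the mean of f t - f x over t between x and y.  Its
    integral is taken over the whole unit interval against the difference D of the indicators
    of [0, y] and [0, x], which treats y < x and x < y alike. *)
Lemma slow_derivative f x K : 0 <= K -> slow_at f x K -> bmeas f -> 0 < x < 1 ->
  has_derivative01_at (primitive01 f) x (f x).
Proof.
move=> K0 slow bf x01; apply/cvgrPdist_lt => e e0.
have e2 : 0 < e / 2 by lra.
have [d d0 hd] := slow_dist K0 slow e2.
exists d => //= y /= xy yx; rewrite in_itv /= => y01.
pose i z := \1_(`[0, z]%classic : set R) : R -> R.
have bi z : bmeas (i z) by exact: bmeas_indic.
have iE z t : 0 <= t -> i z t = (nat_of_bool (t <= z)%R)%:R.
  move=> t0; rewrite /i indicE; congr (_%:R); congr nat_of_bool.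
  by apply/idP/idP; rewrite inE /= in_itv /= ?t0.
have x01' : 0 <= x <= 1 by lra.
pose D t := i y t - i x t.
have bD : bmeas D := bmeas_sub (bi y) (bi x).
have bfD : bmeas (fun t => (f t - f x) * D t) := bmeas_mul (bmeas_sub bf (bmeas_cst _))
  bD.
have Ei z : 0 <= z <= 1 -> int01 (i z) = z.
  by move=> /andP[z0 z1]; rewrite int01_indic_in // subr0.
have FE : primitive01 f y - primitive01 f x - f x * (y - x) = int01 (fun t => (f t - f
  x) * D t).
  rewrite !primitive01E // -{2}(Ei y y01) -{3}(Ei x x01').
  rewrite -(int01_sub (bi y) (bi x)) -(int01_sub (bmeas_mul bf (bi y)) (bmeas_mul bf
    (bi x))).
  rewrite -(int01_scale _ (bmeas_sub (bi y) (bi x))).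
  rewrite -(int01_sub (bmeas_sub (bmeas_mul bf (bi y)) (bmeas_mul bf (bi x)))
    (bmeas_mul (bmeas_cst (f x)) bD)).
  by apply: int01_eq => t _; rewrite /D; ring.
have ED : int01 (fun t => `|D t|) = `|y - x|.
  have [xy'|yx'] := leP x y.
    rewrite ger0_norm ?subr_ge0 // -[in RHS](Ei y y01) -[in RHS](Ei x x01') -(int01_sub
      (bi y) (bi x)).
    apply: int01_eq => t /andP[t0 _]; rewrite ger0_norm // subr_ge0 !iE // ler_nat.
    by case: (leP t x) => //= tx; rewrite (le_trans tx xy').
  rewrite ltr0_norm ?subr_lt0 // opprB -[in RHS](Ei y y01) -[in RHS](Ei x x01')
    -(int01_sub (bi x) (bi y)).
  apply: int01_eq => t /andP[t0 _]; rewrite ler0_norm ?opprB // subr_le0 !iE // ler_nat.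
  by case: (leP t y) => //= ty; rewrite (le_trans ty (ltW yx')).
have bound : `|int01 (fun t => (f t - f x) * D t)| <= e / 2 * `|y - x|.
  apply: (le_trans (int01_norm bfD)); rewrite -ED -(int01_scale _ (bmeas_norm bD)).
  apply: (int01_le (bmeas_norm bfD) (bmeas_mul (bmeas_cst _) (bmeas_norm bD))) => t t01.
  rewrite normrM; have [->|Dt] := eqVneq (D t) 0; first by rewrite normr0 !mulr0.
  rewrite ler_wpM2r // ltW //; apply: hd => //.
  move: Dt xy; rewrite /D !iE ?(proj1 (andP t01)) //.
  rewrite ltr_norml ler_norml.
  by case: (leP t y) => ?; case: (leP t x) => ?; rewrite ?subrr ?eqxx //; lra.
have yx0 : y - x != 0 by rewrite subr_eq0.
have -> : f x - (primitive01 f y - primitive01 f x) / (y - x) =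
   - (int01 (fun t => (f t - f x) * D t) / (y - x)) by rewrite -FE; field.
rewrite normrN normrM normfV ltr_pdivrMr ?normr_gt0 //.
apply: (le_lt_trans bound); rewrite ltr_pM2r ?normr_gt0 //; lra.
Qed.

End DifferentiationAtSlowPoint.

(** * Input contexts *)

(** The schemes bind variables in front, while outputs are curried with their argument last. *)
Lemma comp_last (C : ctx) (F : idx (ext C) -> nat) : computable (ext C) F ->
  exists e, forall (i : idx C) m, kleene e (args i ++ [:: num m])%SEQ (F (i, m)).
Proof.
move=> [e he].
have [||e' he'] := @kleene_select e (width C).+1 (width C :: iota 0 (width C)).
- by rewrite /= mem_iota ltnn iota_uniq.
- by apply/allP => j; rewrite inE mem_iota => /orP[/eqP->//|/andP[_]]; rewrite add0n;
  exact: ltnW.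
exists e' => i m; apply: he'; first by rewrite size_cat size_args addn1.
rewrite /= nth_cat size_args ltnn subnn /=.
suff -> : [seq nth num0 (args i ++ [:: num m])%SEQ j | j <- iota 0 (width C)] = args i.
  exact: (he (i, m)).
rewrite map_nth_iota0; first by rewrite take_size_cat ?size_args.
by rewrite size_cat size_args leq_addr.
Qed.

Section Inputs.
Variable R : realType.

Record input := Input {
  in_fun : R -> R;
  in_phi : (nat -> nat) -> nat -> nat;
  in_inter : intermediate_BV in_fun;
  in_real : realizes in_phi in_fun }.

(** The inputs of the tasks: exists2, a realizer, and n sequences meant as names of reals. *)
Definition inputs (n : nat) : ctx.
Proof.
refine (@Ctx (input * n.-tuple (nat -> nat))
  (fun p => [:: exists2_obj, op_obj (in_phi p.1) & [seq seq_obj x | x <- p.2]]) n.+2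
  (fun p g => in_phi p.1 (fun k => g k.+1) (g 0%N)) 0 1 _ _ _ _ _) => //.
by move=> p; rewrite /= size_map size_tuple.
Defined.

Lemma inputs_oracle n : @oracle R (inputs n) (fun p => in_fun p.1).
Proof. by move=> [[f phi fi fphi] x]; exists phi. Qed.

Lemma Rcomp_input n (k : 'I_n) : computableR (inputs n) (fun p => val R (tnth p.2 k)).
Proof.
apply: Rcomp_val; apply: (@comp_type1 (inputs n) (fun p => tnth p.2 k) k.+2).
  by move=> p; rewrite /= size_map size_tuple !ltnS.
by move=> p /=; rewrite (nth_map (fun=> 0%N)) ?size_tuple // (tnth_nth (fun=> 0%N)).
Qed.

Lemma index_of_name n (r : idx (inputs n) -> R) : computableR (inputs n) r ->
  exists e, forall p m, kleene e (args p ++ [:: num m])%SEQ (name (r p) m).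
Proof. by move=> /comp_name /comp_last. Qed.

End Inputs.

(** * Suprema and moduli from rational values *)

Section Sup.
Variable R : realType.
Implicit Types (f : R -> R) (p q : R).

Definition sup_on f p q : R := sup [set f x | x in `[p, q]].

(** The value at an interior point is exceeded, up to any eps, by a value at a rational. *)
Lemma lt_sup_onP f p q t : intermediate_BV f -> 0 <= p -> p <= q -> q <= 1 ->
  t < sup_on f p q <-> [\/ t < f p, t < f q | exists c, p < rat_real R c < q /\
    t < f (rat_real R c)].
Proof.
move=> fi p0 pq q1; have [bv _] := fi; have [_ [B hB]] := BV_bmeas bv.
have in_le x : p <= x <= q -> f x <= sup_on f p q.
  move=> pxq; apply: ub_le_sup; last by exists x; rewrite //= in_itv.
  exists B => _ [y + <-]; rewrite /= in_itv /= => pyq.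
  by apply: (le_trans (ler_norm _)); apply: hB; lra.
split.
  move=> /sup_gt[|_ [x + <-] tx]; first by exists (f p), p => //=; rewrite in_itv /= lexx.
  rewrite /= in_itv /= => pxq.
  have [xp|xp] := eqVneq x p; first by rewrite -xp; constructor 1.
  have [xq|xq] := eqVneq x q; first by rewrite -xq; constructor 2.
  have {}pxq : p < x < q by rewrite !lt_neqAle eq_sym xp xq.
  have x01 : 0 < x < 1 by lra.
  have e0 : 0 < (f x - t) / 2 by lra.
  have [u [v [+ + h]]] := rational_sides fi x01 pxq e0.
  rewrite gt_max lt_min => /andP[/andP[u1 u2] u3] /andP[v1 /andP[v2 v3]].
  by constructor 3; case: h => ?; [exists v|exists u]; lra.
case=> [h|h|[c [pcq h]]]; apply: (lt_le_trans h); apply: in_le; rewrite ?lexx ?pq //; lra.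
Qed.
End Sup.

Section Moduli.
Variable R : realType.
Implicit Types (f : R -> R) (r x : R).

(** Only rational points are compared with r; the bound is half of the allowed error because it
    becomes a weak inequality at the other points. *)
Definition cont_mod f r (k : nat) : nat := least (fun N => forall c,
  0 <= rat_real R c <= 1 ->
  `|clamp r - rat_real R c| < 2 ^- N ->
    `|f (clamp r) - f (clamp (rat_real R c))| <= 2 ^- k.+1).

(** Values at rationals on the same side of r, within distance d, agree up to half of 2^-k.
    The other half absorbs the passage from one of the two values to the one-sided limit. *)
Definition window f r d (k : nat) : Prop := forall b c,
  0 <= rat_real R b <= 1 -> 0 <= rat_real R c <= 1 ->
  (r < rat_real R b < r + d /\ r < rat_real R c < r + d) \/ (r - d < rat_real R b < r
    /\ r - d < rat_real R c < r) ->
  `|f (clamp (rat_real R b)) - f (clamp (rat_real R c))| <= 2 ^- k.+1.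

Definition reg_mod f r (k : nat) : nat := least (fun N => window f r (2 ^- N.+1) k).

Lemma cont_modP f : intermediate_BV f -> modulus_of_continuity f (cont_mod f).
Proof.
move=> fi k x y x01 cx y01 xy.
have k1 : 0 < 2 ^- k.+1 :> R by rewrite invr_gt0 exprn_gt0.
have : forall c, 0 <= rat_real R c <= 1 -> `|x - rat_real R c| < 2 ^- cont_mod f x k ->
    `|f x - f (rat_real R c)| <= 2 ^- k.+1.
  move=> c c01 xc; have := (@leastP (fun N => forall c, 0 <= rat_real R c <= 1 ->
  `|clamp x - rat_real R c| < 2 ^- N ->
    `|f (clamp x) - f (clamp (rat_real R c))| <= 2 ^- k.+1)).
  rewrite -/(cont_mod f x k) (clamp_id x01) => /(_ _ c c01 xc); rewrite clamp_id //;
    apply.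
  have [d /= d0 hd] := (cvgrPdist_lt _ _).1 cx _ k1.
  have [N /(_ N (leqnn N)) hN] := pow2_small d0; exists N => b b01 xb;
    rewrite clamp_id //.
  by apply/ltW/hd => //=; exact: lt_trans xb hN.
move=> hq; set d := 2 ^- cont_mod f x k in xy hq.
have : f x - 2 ^- k.+1 <= f y <= f x + 2 ^- k.+1.
  apply: (rational_bounds fi (a := x - d) (b := x + d)) => //; last by move: xy;
    rewrite ltr_norml; lra.
  move=> c c01 cd; have cd' : `|x - rat_real R c| < d by rewrite ltr_norml; lra.
  by have := hq c c01 cd'; rewrite ler_norml; lra.
have -> : 2 ^- k = 2 ^- k.+1 + 2 ^- k.+1 :> R by rewrite exprS invfM; lra.
by rewrite ltr_norml; lra.
Qed.

Lemma reg_modP f : intermediate_BV f -> modulus_of_regulation f (reg_mod f).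
Proof.
move=> fi k x x01; have [bv _] := fi.
have k1 : 0 < 2 ^- k.+1 / 2 :> R by rewrite divr_gt0 // invr_gt0 exprn_gt0.
have kE : 2 ^- k = 2 ^- k.+1 + 2 ^- k.+1 :> R by rewrite exprS invfM; lra.
have rl : exists2 d : R, 0 < d & (forall y, 0 <= y <= 1 -> x < y < x + d ->
  `|rlim f x - f y| < 2 ^- k.+1 / 2).
  have [x1|x1] := ltP x 1; last by exists 1 => // y; lra.
  have xr : 0 <= x < 1 by lra.
  by have [d d0 hd] := rlimP bv xr k1; exists d => // y _; exact: hd.
have ll : exists2 d : R, 0 < d & (forall y, 0 <= y <= 1 -> x - d < y < x ->
  `|llim f x - f y| < 2 ^- k.+1 / 2).
  have [x0|x0] := ltP 0 x; last by exists 1 => // y; lra.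
  have xl : 0 < x <= 1 by lra.
  by have [d d0 hd] := llimP bv xl k1; exists d => // y _; exact: hd.
have [d1 d10 h1] := rl; have [d2 d20 h2] := ll.
have : window f x (2 ^- (reg_mod f x k).+1) k.
  apply: (@leastP (fun N => window f x (2 ^- N.+1) k)).
  have d0 : 0 < Num.min d1 d2 by rewrite lt_min d10.
  have [m1 m2] : Num.min d1 d2 <= d1 /\ Num.min d1 d2 <= d2 by rewrite !ge_min !lexx orbT.
  have [N /(_ N.+1 (leqnSn N)) hN] := pow2_small d0; exists N => b c b01 c01 h.
  rewrite !clamp_id //.
  case: h => -[hb hc].
    have := h1 _ b01; have := h1 _ c01; rewrite !ltr_norml ler_norml.
    have -> : x < rat_real R b < x + d1 by lra.
    have -> : x < rat_real R c < x + d1 by lra.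
    by move=> /(_ isT) + /(_ isT); lra.
  have := h2 _ b01; have := h2 _ c01; rewrite !ltr_norml ler_norml.
  have -> : x - d2 < rat_real R b < x by lra.
  have -> : x - d2 < rat_real R c < x by lra.
  by move=> /(_ isT) + /(_ isT); lra.
have w0 : 0 < 2 ^- (reg_mod f x k).+1 :> R by rewrite invr_gt0 exprn_gt0.
set w := 2 ^- _ in w0 *; move=> hw; split.
  move=> y y01 xyw.
  have x1 : x < 1 by lra.
  have [c /andP[c1 c2]] : exists c,
    x < rat_real R c < Num.min 1 (Num.min (x + d1) (x + w)).
    by apply: rat_real_dense; rewrite !lt_min; lra.
  move: c2; rewrite !lt_min => /andP[c2 /andP[c3 c4]].
  have c01 : 0 <= rat_real R c <= 1 by lra.
  have : f (rat_real R c) - 2 ^- k.+1 <= f y <= f (rat_real R c) + 2 ^- k.+1.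
    apply: (rational_bounds fi (a := x) (b := x + w)) => // b b01 bw.
    have := hw b c b01 c01; rewrite !clamp_id // ler_norml => h.
    by have := h (or_introl (conj bw (introT andP (conj c1 c4)))); lra.
  have := h1 _ c01; rewrite c1 c3 !ltr_norml => /(_ isT).
  by lra.
move=> y y01 xyw.
have x0 : 0 < x by lra.
have [c /andP[c1 c2]] : exists c, Num.max 0 (Num.max (x - d2) (x - w)) < rat_real R c < x.
  by apply: rat_real_dense; rewrite !gt_max; lra.
move: c1; rewrite !gt_max => /andP[c1 /andP[c3 c4]].
have c01 : 0 <= rat_real R c <= 1 by lra.
have : f (rat_real R c) - 2 ^- k.+1 <= f y <= f (rat_real R c) + 2 ^- k.+1.
  apply: (rational_bounds fi (a := x - w) (b := x)) => // b b01 bw.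
  have := hw b c b01 c01; rewrite !clamp_id // ler_norml => h.
  by have := h (or_intror (conj bw (introT andP (conj c4 c2)))); lra.
have := h2 _ c01; rewrite c2 c3 !ltr_norml => /(_ isT).
by lra.
Qed.

End Moduli.

(** * Programs for suprema and moduli *)

Section Programs.
Variable R : realType.
Implicit Types (C : ctx).

Lemma Rcomp_sup_on C (f : idx C -> R -> R) (p q : idx C -> R) : @oracle R C f ->
  (forall i, intermediate_BV (f i)) -> computableR C p -> computableR C q ->
  (forall i, 0 <= p i <= q i) -> (forall i, q i <= 1) ->
  computableR C (fun i => sup_on (f i) (p i) (q i)).
Proof.
move=> of_ fi cp cq pq q1; have o1 := oracle_ext of_; have o2 := oracle_ext o1.
apply: (@eq_dec (ext C) (fun i => (rat_real R i.2 < f i.1 (clamp (p i.1)) \/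
   rat_real R i.2 < f i.1 (clamp (q i.1))) \/
   exists c, p i.1 < rat_real R c < q i.1 /\
     rat_real R i.2 < f i.1 (clamp (rat_real R c)))).
  move=> [i t] /=; have /andP[p0 pq'] := pq i; rewrite lt_sup_onP //.
  rewrite !clamp_id ?p0 ?q1 ?(le_trans pq') ?(le_trans p0) //.
  split=> [[[h|h]|[c [pcq h]]]|[h|h|[c [pcq h]]]].
  - by constructor 1.
  - by constructor 2.
  - constructor 3; exists c; split => //; rewrite clamp_id // in h.
    by have := q1 i; lra.
  - by left; left.
  - by left; right.
  - right; exists c; split => //; rewrite clamp_id //.
    by have := q1 i; lra.
apply: dec_or; [apply: dec_or|apply: dec_ex; apply: dec_and; first by decide_real].
- by apply: dec_lt; [decide_real|apply: (Rcomp_fclamp o1); decide_real].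
- by apply: dec_lt; [decide_real|apply: (Rcomp_fclamp o1); decide_real].
- by apply: dec_lt; [decide_real|apply: (Rcomp_fclamp o2); decide_real].
Qed.

Lemma comp_cont_mod C (f : idx C -> R -> R) (r : idx C -> R) : @oracle R C f ->
  computableR C r -> computable (ext C) (fun p => cont_mod (f p.1) (r p.1) p.2).
Proof.
move=> of_ cr; have o3 := oracle_ext (oracle_ext (oracle_ext of_)).
apply: (comp_least (C := ext C) (P := fun p N => forall c, 0 <= rat_real R c <= 1 ->
  `|clamp (r p.1) - rat_real R c| < 2 ^- N ->
  `|f p.1 (clamp (r p.1)) - f p.1 (clamp (rat_real R c))| <= 2 ^- p.2.+1)).
apply: dec_all; apply: dec_imp; first by decide_real.
apply: dec_imp.
  by apply: dec_lt; [apply: Rcomp_norm; apply: Rcomp_sub; [apply: Rcomp_clamp|]|];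
    decide_real.
apply: dec_le; last by decide_real.
by apply: Rcomp_norm; apply: Rcomp_sub; apply: (Rcomp_fclamp o3); decide_real.
Qed.

Lemma comp_reg_mod C (f : idx C -> R -> R) (r : idx C -> R) : @oracle R C f ->
  computableR C r -> computable (ext C) (fun p => reg_mod (f p.1) (r p.1) p.2).
Proof.
move=> of_ cr; have o4 := oracle_ext (oracle_ext (oracle_ext (oracle_ext of_))).
apply: (comp_least (C := ext C) (P := fun p N => window (f p.1) (r p.1) (2 ^- N.+1) p.2)).
rewrite /window; apply: dec_all; apply: dec_all; do 2 (apply: dec_imp;
  first by decide_real).
apply: dec_imp; first by decide_real.
apply: dec_le; last by decide_real.
by apply: Rcomp_norm; apply: Rcomp_sub; apply: (Rcomp_fclamp o4); decide_real.
Qed.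

End Programs.

(** * The tasks *)

Section Tasks.
Variables (R : realType) (K : set (R -> R)).
Hypothesis sub : forall f, K f -> intermediate_BV f.

Let arg f phi (Kf : K f) (fphi : realizes phi f) : input R := Input (sub Kf) fphi.

Lemma task_sup : exists e : nat, forall (f : R -> R) phi (p q : R) xp xq,
     K f -> realizes phi f -> 0 <= p -> p <= q -> q <= 1 ->
     represents xp p -> represents xq q ->
     exists2 y, represents y (sup [set f x | x in `[p, q]]) &
       computes1 exists2_obj e [:: op_obj phi; seq_obj xp; seq_obj xq] y.
Proof.
pose C := inputs R 2; pose p (i : idx C) := clamp (val R (tnth i.2 ord0)).
(* The maximum keeps the interval non-empty for input sequences that name no p <= q. *)
pose q (i : idx C) := Num.max (p i) (clamp (val R (tnth i.2 ord_max))).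
have cp : computableR C p by apply: Rcomp_clamp; exact: Rcomp_input.
have cq : computableR C q by apply: Rcomp_max cp _; apply: Rcomp_clamp;
  exact: Rcomp_input.
have pq01 i : 0 <= p i <= q i.
  by apply/andP; split; last (by rewrite /q le_max lexx);
    case/andP: (clamp_itv (val R (tnth i.2 ord0))).
have q1 i : q i <= 1.
  by rewrite /q /p ge_max; do 2 rewrite (proj2 (andP (clamp_itv _))).
have fi (i : idx C) : intermediate_BV (in_fun i.1) by case: i => [[]].
have [e he] := index_of_name (Rcomp_sup_on (@inputs_oracle R 2) fi cp cq pq01 q1).
exists e => f phi p0 q0 xp xq Kf fphi p00 pq q01 xp0 xq0.
exists (name (sup_on f p0 q0)); first exact: represents_name.
move=> m; have := he (arg Kf fphi, [tuple xp; xq]) m.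
rewrite /q /p /= !(tnth_nth (fun=> 0%N)) /= (val_represents xp0) (val_represents xq0).
have [p01 q01'] : 0 <= p0 <= 1 /\ 0 <= q0 <= 1 by lra.
by rewrite (clamp_id p01) (clamp_id q01') max_r.
Qed.

Lemma task_jordan : exists e1 e2 : nat, forall (f : R -> R) phi, K f -> realizes phi f ->
     exists (g h : R -> R) gamma eta,
       [/\ nondecreasing01 g, nondecreasing01 h &
         forall x, 0 <= x <= 1 -> f x = g x - h x] /\
       [/\ realizes gamma g, realizes eta h,
         computes2 exists2_obj e1 [:: op_obj phi] gamma &
         computes2 exists2_obj e2 [:: op_obj phi] eta].
Proof.
pose C := inputs R 1; pose x (i : idx C) := clamp (val R (tnth i.2 ord0)).
have cx : computableR C x by apply: Rcomp_clamp; exact: Rcomp_input.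
have of_ := @inputs_oracle R 1.
have x01 i : 0 <= x i <= 1 by exact: clamp_itv.
have cW : computableR C (fun i => rat_variation (in_fun i.1) (x i)).
  by apply: (Rcomp_variation of_ cx) => // -[[]].
have cf : computableR C (fun i => in_fun i.1 (x i)) by exact: Rcomp_oracle of_ cx x01.
have [e1 he1] := index_of_name cW.
have [e2 he2] := index_of_name (Rcomp_sub cW cf).
exists e1, e2 => f phi Kf fphi; have fi := sub Kf.
pose W := rat_variation f.
exists W, (fun r => W r - f r), (fun u => name (W (clamp (val R u)))),
  (fun u => name (W (clamp (val R u)) - f (clamp (val R u)))).
split; split.
- exact: rat_variation_mono.
- move=> s t s0 st t1; have := rat_variation_step fi s0 st t1.
  by have := ler_norm (f t - f s); rewrite -/W; lra.
- by move=> t _; rewrite opprB addrC subrK.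
- by move=> u r r01 ur; rewrite (val_represents ur) clamp_id //; exact: represents_name.
- by move=> u r r01 ur; rewrite (val_represents ur) clamp_id //; exact: represents_name.
- by move=> u m; exact: (he1 (arg Kf fphi, [tuple u]) m).
- by move=> u m; exact: (he2 (arg Kf fphi, [tuple u]) m).
Qed.

(** A single index serves for all tasks that return a point. *)
Lemma task_point : exists e : nat, forall f phi, K f -> realizes phi f ->
  computes1 exists2_obj e [:: op_obj phi] (name (var_point f)).
Proof.
have cv : computableR (inputs R 0) (fun i => var_point (in_fun i.1)).
  by apply: Rcomp_var_point; [exact: inputs_oracle|move=> [[]]].
have [e he] := index_of_name cv; exists e => f phi Kf fphi m.
exact: (he (arg Kf fphi, [tuple]) m).
Qed.

Lemma task_returns_point (L : set (R -> R)) (P : (R -> R) -> R -> Prop) :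
  (forall f, L f -> K f) ->
  (forall f B, L f -> bmeas f -> 0 < var_point f < 1 -> 0 <= B ->
    slow_at f (var_point f) B -> P f (var_point f)) ->
  returns_point L P.
Proof.
move=> LK hP; have [e he] := task_point; exists e => f phi Lf fphi.
have Kf := LK f Lf; have fi := sub Kf; have [x01 [B B0 slow]] := var_point_slow fi.
exists (var_point f), (name (var_point f)); split.
- by lra.
- by apply: (hP f B) => //; apply: BV_bmeas; case: fi.
- exact: represents_name.
- exact: he.
Qed.

Lemma task_returns_modulus (P : (R -> R) -> (R -> nat -> nat) -> Prop)
    (m : (R -> R) -> R -> nat -> nat) :
  (forall f, intermediate_BV f -> P f (m f)) ->
  (forall (C : ctx) (f : idx C -> R -> R) (r : idx C -> R), @oracle R C f ->
    computableR C r -> computable (ext C) (fun p => m (f p.1) (r p.1) p.2)) ->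
  returns_modulus K P.
Proof.
move=> hP cm; have := cm _ _ _ (@inputs_oracle R 1) (@Rcomp_input R 1 ord0).
move=> /comp_last[e he]; exists e => f phi Kf fphi.
exists (m f), (fun u => m f (val R u)); split.
- exact/hP/sub.
- by move=> u r ur k; rewrite (val_represents ur).
- by move=> u k; exact: (he (arg Kf fphi, [tuple u]) k).
Qed.

End Tasks.

Theorem theorem2p26 (R : realType) (K : set (R -> R)) :
  [\/ K = @normalised_BV R, K = @quasi_continuous_BV R,
      K = @intermediate_BV R | K = @mean_BV R] ->
  (* (a) *)
  (exists e : nat, forall (f : R -> R) phi (p q : R) xp xq,
     K f -> realizes phi f -> 0 <= p -> p <= q -> q <= 1 ->
     represents xp p -> represents xq q ->
     exists2 y, represents y (sup [set f x | x in `[p, q]]) &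
       computes1 exists2_obj e [:: op_obj phi; seq_obj xp; seq_obj xq] y) /\
  (* (b) *)
  (exists e1 e2 : nat, forall (f : R -> R) phi, K f -> realizes phi f ->
     exists (g h : R -> R) gamma eta,
       [/\ nondecreasing01 g, nondecreasing01 h &
         forall x, 0 <= x <= 1 -> f x = g x - h x] /\
       [/\ realizes gamma g, realizes eta h,
         computes2 exists2_obj e1 [:: op_obj phi] gamma &
         computes2 exists2_obj e2 [:: op_obj phi] eta]) /\
  (* (c) *)
  returns_point K (fun f x => continuous01_at f x) /\
  (* (d) *)
  returns_point K (fun f x => fourier_sum f N x @[N --> \oo] --> f x) /\
  (* (e) *)
  returns_point
    [set f | [/\ K f, forall x, 0 <= x <= 1 -> 0 <= f x <= 1 &
               \int[lebesgue_measure]_(x in `[0, 1]) f x = 0]]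
    (fun f x => f x = 0) /\
  (* (f) *)
  returns_point K
    (fun f x => has_derivative01_at (primitive01 f) x (f x)) /\
  (* (g) *)
  returns_modulus K (fun f m => modulus_of_continuity f m) /\
  (* (h) *)
  returns_modulus K (fun f m => modulus_of_regulation f m).
Proof.
move=> hK; have sub f : K f -> intermediate_BV f.
  case: hK => -> //; [exact: normalised_intermediate|
    exact: quasi_continuous_intermediate|exact: mean_intermediate].
split; first exact: task_sup.
split; first exact: task_jordan.
split; first by apply: (task_returns_point sub) => // f B _ _ _; exact: slow_continuous.
split.
  by apply: (task_returns_point sub) => // f B _ bf x01 B0 slow; exact: fourier_cvg slow.
split.
  apply: (task_returns_point sub) => [f []//|f B [_ f01 f0] bf x01 B0 slow].
  by apply: (slow_zero B0 slow bf x01) => // t /f01/andP[].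
split.
  by apply: (task_returns_point sub) => // f B _ bf x01 B0 slow; exact: slow_derivative slow bf x01.
split; apply: (task_returns_modulus sub).
- exact: cont_modP.
- exact: comp_cont_mod.
- exact: reg_modP.
- exact: comp_reg_mod.
Qed.
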